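(* For all integers $n>k\geqslant 2$ there exists an $(n,k)$-uframe $S$ at which the function $F(S')=\vol\left(\mathop{\rm co}\{\pm v'_1,\ldots,\pm v'_n\}\right)$, $S'=(v'_1,\dots,v'_n)\in\Omega(n,k)$, attains a local maximum on $\Omega(n,k)$ which is not its global maximum on $\Omega(n,k)$.
   Context: An $(n,k)$-frame is an ordered $n$-tuple of vectors in $\mathbb{R}^k$ spanning $\mathbb{R}^k$ (repetitions and zero vectors allowed). It is an $(n,k)$-uframe if $\sum_{i=1}^n v_i\otimes v_i=I_k$. $\Omega(n,k)$ is the set of all $(n,k)$-uframes, viewed as a subset of $\mathbb{R}^{k\times n}$ with the Euclidean topology. $\vol$ is $k$-dimensional volume. (Equivalently, $F$ corresponds to the volume of the orthogonal projection of the cross-polytope $\{x\in\mathbb{R}^n:\sum|x[i]|\leqslant1\}$ onto a $k$-dimensional subspace.) *)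

(* Defs.v *)
From HB Require Import structures.
From mathcomp Require Import all_boot all_order all_algebra.
From mathcomp Require Import all_classical all_reals all_analysis.
Set Implicit Arguments. Unset Strict Implicit. Unset Printing Implicit Defensive.
Import Order.TTheory GRing.Theory Num.Theory.
Import numFieldNormedType.Exports.
Local Open Scope classical_set_scope.
Local Open Scope ring_scope.

(* An (n,k)-frame S = (v_1,...,v_n) is stored as the k x n matrix whose
   i-th column is v_i. *)

Definition frame (R : realType) (n k : nat) (S : 'M[R]_(k, n)) : Prop :=
  \rank S = k.

(* (n,k)-uframe: a frame with sum_i v_i v_i^T = I_k, i.e. S S^T = I_k. *)
Definition uframe (R : realType) (n k : nat) (S : 'M[R]_(k, n)) : Prop :=
  frame S /\ S *m S^T = 1%:M.

Definition Omega (R : realType) (n k : nat) : set 'M[R]_(k, n) :=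
  [set S | uframe S].

Definition sym_hull (R : realType) (n k : nat) (S : 'M[R]_(k, n))
  : set 'cV[R]_k :=
  [set x | exists lam mu : 'I_n -> R,
     [/\ forall i, 0 <= lam i, forall i, 0 <= mu i,
         \sum_i lam i + \sum_i mu i = 1 &
         x = \sum_i (lam i *: col i S + mu i *: (- col i S))]].

Definition box (R : realType) (k : nat) (a b : 'cV[R]_k) : set 'cV[R]_k :=
  [set x | forall i, a i ord0 <= x i ord0 <= b i ord0].

(* k-dimensional volume: Lebesgue (outer) measure on R^k, defined as the
   infimum of the total volume of countable covers by boxes.
   (For the compact convex sets considered here this is their Lebesgue
   measure.) *)
Definition vol (R : realType) (k : nat) (A : set 'cV[R]_k) : \bar R :=
  ereal_inf [set s : \bar R | exists a b : nat -> 'cV[R]_k,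
     [/\ forall j i, a j i ord0 <= b j i ord0,
          A `<=` \bigcup_j box (a j) (b j) &
          s = (\sum_(0 <= j <oo) (\prod_i (b j i ord0 - a j i ord0))%:E)%E]].

Definition F (R : realType) (n k : nat) (S : 'M[R]_(k, n)) : \bar R :=
  vol (sym_hull S).

(* Main.v *)
Require Import Defs.
From HB Require Import structures.
From mathcomp Require Import all_boot all_order all_algebra.
From mathcomp Require Import all_classical all_reals all_analysis.
From mathcomp Require Import perm measurable_realfun ring lra.
Set Implicit Arguments.
Unset Strict Implicit.
Unset Printing Implicit Defensive.
Import Order.TTheory GRing.Theory Num.Theory.
Import numFieldNormedType.Exports.
Local Open Scope classical_set_scope.
Local Open Scope ring_scope.

(* The local maximum is the uframe made of a regular hexagon {+-a, +-b, +-c} with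
   b = a + c, of an orthonormal basis of the orthogonal complement of its plane,
   and of zero vectors.  For a nearby uframe let M be the square matrix of the
   vectors close to a, c and the orthonormal basis, and write b' = M v for the one
   close to b.  The hull keeps the combinatorial type of the join of the hexagon with
   the remaining pairs +-w, whence vol <= 2 q |det M| (1 + v_0 + v_1), where q is the
   volume of the part x_0, x_1 >= 0 of the unit l1-ball.  Up to sign
   |det M| (1 + v_0 + v_1) is the determinant of the (k+1) x (k+1) matrix
   [[-1, e^T], [b', M]] with e = e_0 + e_1, whose first row has norm sqrt 3 and
   whose other rows have norm at most 1; Hadamard's inequality bounds it
   by sqrt 3, with equality at the hexagonal frame.  The standard cross-polytope has
   volume 4 q > 2 sqrt 3 q.
   On the measure side one needs that linear maps scale [vol] by |det| (elementary
   matrices, a shear being handled by slicing boxes), that [vol] is superadditive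
   across a hyperplane (cut every box of a cover along it), and that 0 < q < oo. *)

(** * Volume as an outer measure *)

Section Volume.
Context {R : realType}.

Definition box_vol k (a b : 'cV[R]_k) : R := \prod_i (b i ord0 - a i ord0).

Definition box_cover k (A : set 'cV[R]_k) (a b : nat -> 'cV[R]_k) :=
  (forall j i, a j i ord0 <= b j i ord0) /\ A `<=` \bigcup_j box (a j) (b j).

Lemma box_volD1 k (i : 'I_k) (a b : 'cV[R]_k) : box_vol a b =
  (b i ord0 - a i ord0) * \prod_(l < k | l != i) (b l ord0 - a l ord0).
Proof. by rewrite /box_vol (bigD1 i). Qed.

Lemma box_vol_ge0 k (a b : 'cV[R]_k) :
  (forall i, a i ord0 <= b i ord0) -> 0 <= box_vol a b.
Proof. by move=> ab; apply: prodr_ge0 => i _; rewrite subr_ge0. Qed.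

Lemma vol_le_cover k (A : set 'cV[R]_k) a b : box_cover A a b ->
  (vol A <= \sum_(0 <= j <oo) (box_vol (a j) (b j))%:E)%E.
Proof. by case=> ab Aab; apply: ereal_inf_lbound; exists a, b. Qed.

Lemma cover_series_ge0 k (A : set 'cV[R]_k) a b : box_cover A a b ->
  (0 <= \sum_(0 <= j <oo) (box_vol (a j) (b j))%:E)%E.
Proof.
by case=> ab _; apply: nneseries_ge0 => j _ _; rewrite lee_fin box_vol_ge0.
Qed.

Lemma vol_ge k (A : set 'cV[R]_k) (v : \bar R) :
  (forall a b, box_cover A a b ->
     (v <= \sum_(0 <= j <oo) (box_vol (a j) (b j))%:E)%E) -> (v <= vol A)%E.
Proof.
by move=> H; apply: le_ereal_inf_tmp => _ [a [b [ab Aab ->]]]; apply: H.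
Qed.

Lemma vol_ge0 k (A : set 'cV[R]_k) : (0 <= vol A)%E.
Proof. by apply: vol_ge => a b; apply: cover_series_ge0. Qed.

Lemma vol_lt_cover k (A : set 'cV[R]_k) (v : \bar R) : (vol A < v)%E ->
  exists a b, box_cover A a b /\
    (\sum_(0 <= j <oo) (box_vol (a j) (b j))%:E < v)%E.
Proof.
by move=> /ereal_inf_lt[_ [a [b [ab Aab ->]]] lt_v]; exists a, b.
Qed.

Lemma le_vol k (A B : set 'cV[R]_k) : A `<=` B -> (vol A <= vol B)%E.
Proof.
move=> AB; apply: vol_ge => a b [ab Bab]; apply: vol_le_cover.
by split=> //; apply: subset_trans Bab.
Qed.

Lemma vol_subadditive k (A : set 'cV[R]_k) (B : nat -> set 'cV[R]_k) :
  A `<=` \bigcup_i B i -> (vol A <= \sum_(0 <= i <oo) vol (B i))%E.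
Proof.
move=> AB; have [[i Bi]|Boo] := pselect (exists i, vol (B i) = +oo%E).
  by rewrite (nneseries_pinfty _ _ Bi) ?leey// => n _; exact: vol_ge0.
apply/lee_addgt0Pr => e e0.
apply: (le_trans _ (epsilon_trick xpredT (fun n => vol_ge0 (B n)) (ltW e0))).
have covB n : exists ab : (nat -> 'cV[R]_k) * (nat -> 'cV[R]_k),
    box_cover (B n) ab.1 ab.2 /\ (\sum_(0 <= j <oo)
      (box_vol (ab.1 j) (ab.2 j))%:E <= vol (B n) + (e / (2 ^ n.+1)%:R)%:E)%E.
  have : (vol (B n) < vol (B n) + (e / (2 ^ n.+1)%:R)%:E)%E.
    rewrite lteDl ?lte_fin ?divr_gt0 ?ltr0n ?expn_gt0//.
    by rewrite ge0_fin_numE ?vol_ge0// ltey; apply/eqP => Bn; apply: Boo; exists n.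
  by move=> /vol_lt_cover[a [b [cov /ltW le_v]]]; exists (a, b).
have [G PG] := choice covB.
(* A bijection [f] from [nat] to [nat * nat] flattens the family of covers into a single sequence of
   boxes. *)
have /card_esym/ppcard_eqP[f] := card_nat2.
pose v (p : nat * nat) : \bar R := (box_vol ((G p.1).1 p.2) ((G p.1).2 p.2))%:E.
have v_ge0 p : (0 <= v p)%E by rewrite lee_fin box_vol_ge0//; case: (PG p.1) => -[].
have cov : box_cover A (fun m => (G (f m).1).1 (f m).2) (fun m => (G (f m).1).2 (f m).2).
  split=> [j i|x /AB[i _ Bx]]; first by case: (PG (f j).1) => -[].
  case: (PG i) => -[_ /(_ x Bx)[j _ xj]] _.
  by exists (f^-1%FUN (i, j)) => //=; rewrite invK ?inE.
apply: (le_trans (vol_le_cover cov)).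
rewrite -/(\sum_(0 <= m <oo) v (f m))%E.
have reindex_f : \esum_(m in setT) v (f m) = \esum_(p in setT) v p.
  by apply/esym/reindex_esum; exact: 'bij_f.
rewrite (nneseries_esumT (a := fun m => v (f m)))// reindex_f.
rewrite [X in esum X _](_ : _ = [set: nat] `*`` (fun=> [set: nat])); last first.
  by apply/seteqP; split.
rewrite (_ : v = fun p => v (p.1, p.2)); last by apply/funext => -[].
rewrite -(esum_esum (a := fun i j => v (i, j)))//.
rewrite -nneseries_esumT; last by move=> n; apply: esum_ge0.
apply: lee_nneseries => [i _ _|n _]; first exact: esum_ge0.
by rewrite -nneseries_esumT//; case: (PG n).
Qed.

(** Covers are infinite sequences, so the box is followed by copies of the one-point box at [a].
    These have volume 0 only in positive dimension: in dimension 0 each box has volume 1, the empty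
    product. This is why dimensions are often written [k.+1]. *)
Lemma vol_box k (a b : 'cV[R]_k.+1) : (forall i, a i ord0 <= b i ord0) ->
  (vol (box a b) <= (box_vol a b)%:E)%E.
Proof.
move=> ab; pose c j := if j is 0%N then b else a.
have cov : box_cover (box a b) (fun=> a) c.
  by split=> [[|j] i //=|x xab]; exists 0%N.
apply: (le_trans (vol_le_cover cov)).
rewrite (nneseriesD1 (n := 0%N))//; last first.
  by move=> j _; rewrite lee_fin box_vol_ge0//; case: cov.
rewrite eseries0 ?adde0// => -[|j]//= _ _.
by rewrite /box_vol big_ord_recl subrr mul0r.
Qed.

Lemma vol_set0 k : vol (set0 : set 'cV[R]_k.+1) = 0%E.
Proof.
apply/eqP; rewrite eq_le vol_ge0 andbT.
apply: (@le_trans _ _ (vol (box (0 : 'cV[R]_k.+1) 0))); first exact: le_vol.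
apply: (le_trans (vol_box _)) => //; rewrite lee_fin.
by rewrite /box_vol big_ord_recl subrr mul0r.
Qed.

Lemma vol_setU k (A B : set 'cV[R]_k.+1) : (vol (A `|` B) <= vol A + vol B)%E.
Proof.
apply: (@le_trans _ _ (\sum_(0 <= i <oo) vol (bigcup2 A B i))%E).
  by apply: vol_subadditive; rewrite bigcup2E.
rewrite (nneseries_split 0 2); last by move=> *; exact: vol_ge0.
rewrite add0n !big_nat_recr//= big_geq//= add0r eseries0 ?adde0//.
by move=> [|[|i]]//= _ _; rewrite vol_set0.
Qed.

Lemma max_clip (a b : R) : a <= b -> Num.max a 0 <= Num.max b 0 /\
  (forall x, a <= x <= b -> 0 <= x -> Num.max a 0 <= x <= Num.max b 0).
Proof.
move=> ab; split=> [|x /andP[ax xb] x0]; first by rewrite ge_max !le_max ab lexx orbT.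
by rewrite ge_max le_max ax x0 xb.
Qed.

Lemma min_clip (a b : R) : a <= b -> Num.min a 0 <= Num.min b 0 /\
  (forall x, a <= x <= b -> x <= 0 -> Num.min a 0 <= x <= Num.min b 0).
Proof.
move=> ab; split=> [|x /andP[ax xb] x0]; first by rewrite le_min !ge_min ab lexx orbT.
by rewrite le_min ge_min ax x0 xb.
Qed.

(** Clipping the i-th sides of a cover of [A] to the nonnegative and to the nonpositive half-line
    gives covers of [A1] and of [A2]. The two clipped lengths add up exactly to the original one,
    since max(x,0) + min(x,0) = x. No measurability is involved. *)
Lemma vol_split k (i : 'I_k) (A A1 A2 : set 'cV[R]_k) :
  A1 `<=` A -> A2 `<=` A -> (forall x, A1 x -> 0 <= x i ord0) ->
  (forall x, A2 x -> x i ord0 <= 0) -> (vol A1 + vol A2 <= vol A)%E.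
Proof.
move=> A1A A2A A1ge0 A2le0; apply: vol_ge => a b [ab Aab].
pose clip (op : R -> R -> R) (x : 'cV[R]_k) : 'cV[R]_k :=
  \col_l if l == i then op (x l ord0) 0 else x l ord0.
have cov1 : box_cover A1 (fun j => clip Num.max (a j)) (fun j => clip Num.max (b j)).
  split=> [j l|x A1x].
    by rewrite !mxE; case: eqP => // _; exact: (max_clip (ab j l)).1.
  have [j _ xj] := Aab x (A1A _ A1x); exists j => // l; rewrite !mxE.
  case: eqP => [->|_]; last exact: xj.
  exact: (max_clip (ab j i)).2 (xj i) (A1ge0 x A1x).
have cov2 : box_cover A2 (fun j => clip Num.min (a j)) (fun j => clip Num.min (b j)).
  split=> [j l|x A2x].
    by rewrite !mxE; case: eqP => // _; exact: (min_clip (ab j l)).1.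
  have [j _ xj] := Aab x (A2A _ A2x); exists j => // l; rewrite !mxE.
  case: eqP => [->|_]; last exact: xj.
  exact: (min_clip (ab j i)).2 (xj i) (A2le0 x A2x).
apply: (le_trans (leeD (vol_le_cover cov1) (vol_le_cover cov2))).
rewrite -nneseriesD; last 2 first.
- by move=> j _ _; rewrite lee_fin box_vol_ge0//; case: cov1.
- by move=> j _ _; rewrite lee_fin box_vol_ge0//; case: cov2.
rewrite le_eqVlt; apply/orP; left; apply/eqP/eq_eseriesr => j _.
rewrite -EFinD; congr _%:E; rewrite !(box_volD1 i) !mxE !eqxx.
have rest op : \prod_(l < k | l != i) (clip op (b j) l ord0 - clip op (a j) l ord0) =
    \prod_(l < k | l != i) (b j l ord0 - a j l ord0).
  by apply: eq_bigr => l /negbTE li; rewrite !mxE li.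
rewrite !rest -mulrDl; congr (_ * _).
rewrite addrACA -opprD !addr_max_min; ring.
Qed.

End Volume.

(** * Volume of linear images *)

Section LinearScaling.
Context {R : realType}.

(** Only one inequality is asked for, because it is stable under products and can be tested on
    boxes; applying it to the inverse matrix then gives equality in [vol_linear]. *)
Definition lin_bounded k (M : 'M[R]_k) := \det M != 0 /\
  forall A, (vol (mulmx M @` A) <= `|\det M|%:E * vol A)%E.

(** The images of the boxes of a cover of [A] cover the image of [A], so countable subadditivity
    reduces the bound to single boxes. *)
Lemma lin_bounded_box k (M : 'M[R]_k) : \det M != 0 ->
  (forall a b : 'cV[R]_k, (forall i, a i ord0 <= b i ord0) ->
     (vol (mulmx M @` box a b) <= (`|\det M| * box_vol a b)%:E)%E) ->
  lin_bounded M.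
Proof.
move=> M0 bM; split=> // A; have M_gt0 : 0 < `|\det M| by rewrite normr_gt0.
rewrite -lee_pdivrMl//; apply: vol_ge => a b [ab Aab].
rewrite lee_pdivrMl//.
apply: (@le_trans _ _ (\sum_(0 <= j <oo) vol (mulmx M @` box (a j) (b j)))%E).
  by apply: vol_subadditive => _ [x /Aab[j _ xj] <-]; exists j => //=; exists x.
rewrite -nneseriesZl; last by move=> j _; rewrite lee_fin box_vol_ge0.
apply: lee_nneseries => [j _ _|j _]; first exact: vol_ge0.
by rewrite -EFinM; exact: bM.
Qed.

Lemma lin_bounded_mul k (M N : 'M[R]_k) :
  lin_bounded M -> lin_bounded N -> lin_bounded (M *m N).
Proof.
move=> [M0 bM] [N0 bN]; rewrite /lin_bounded det_mulmx mulf_neq0//.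
split=> // A; have -> : mulmx (M *m N) @` A = mulmx M @` (mulmx N @` A).
  by rewrite image_comp; apply: eq_imagel => x _ /=; rewrite mulmxA.
apply: (le_trans (bM _)); rewrite normrM EFinM -muleA.
by apply: lee_wpmul2l => //; rewrite lee_fin.
Qed.

Lemma lin_bounded_tperm k (i j : 'I_k.+1) : lin_bounded (tperm_mx i j : 'M[R]_k.+1).
Proof.
have detP : `|\det (tperm_mx i j : 'M[R]_k.+1)| = 1.
  by rewrite det_perm normrX normrN1 expr1n.
apply: lin_bounded_box => [|a b ab]; first by rewrite -normr_gt0 detP.
have actP (x : 'cV[R]_k.+1) l : (tperm_mx i j *m x) l ord0 = x (tperm i j l) ord0.
  by rewrite -row_permE mxE.
pose perm x : 'cV[R]_k.+1 := tperm_mx i j *m x.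
apply: (@le_trans _ _ (vol (box (perm a) (perm b)))).
  by apply: le_vol => _ [x xab <-] l; rewrite !actP.
apply: (le_trans (vol_box _)) => [l|]; first by rewrite !actP.
rewrite lee_fin detP mul1r /box_vol.
rewrite [leRHS](reindex_inj (@perm_inj _ (tperm i j))).
by rewrite le_eqVlt; apply/orP; left; apply/eqP/eq_bigr => l _; rewrite !actP.
Qed.

Lemma max_sub_min (t u v : R) : u <= v ->
  Num.max (t * u) (t * v) - Num.min (t * u) (t * v) = `|t| * (v - u).
Proof.
move=> uv; have v_u : `|u - v| = v - u by rewrite distrC ger0_norm ?subr_ge0.
by rewrite maxr_absE minr_absE -mulrBr normrM v_u; field.
Qed.

Lemma lin_bounded_diag k (d : 'rV[R]_k.+1) : (forall i, d ord0 i != 0) ->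
  lin_bounded (diag_mx d).
Proof.
move=> d0; have det0 : \det (diag_mx d) != 0.
  by rewrite det_diag; apply/prodf_neq0 => i _.
apply: lin_bounded_box => // a b ab.
have actD (x : 'cV[R]_k.+1) l : (diag_mx d *m x) l ord0 = d ord0 l * x l ord0.
  by rewrite mul_diag_mx mxE.
(* A negative diagonal entry exchanges the endpoints of a side, whence the minimum and the
   maximum. *)
pose a' : 'cV[R]_k.+1 := \col_l Num.min (d ord0 l * a l ord0) (d ord0 l * b l ord0).
pose b' : 'cV[R]_k.+1 := \col_l Num.max (d ord0 l * a l ord0) (d ord0 l * b l ord0).
have width l : b' l ord0 - a' l ord0 = `|d ord0 l| * (b l ord0 - a l ord0).
  by rewrite !mxE max_sub_min.
apply: (@le_trans _ _ (vol (box a' b'))).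
  apply: le_vol => _ [x xab <-] l; have /andP[ax xb] := xab l.
  rewrite actD !mxE ge_min le_max.
  case: (leP 0 (d ord0 l)) => [dl|/ltW dl].
    by rewrite (ler_wpM2l dl ax) (ler_wpM2l dl xb) !orbT.
  by rewrite (ler_wnM2l dl ax) (ler_wnM2l dl xb) !orbT.
apply: (le_trans (vol_box _)) => [l|].
  by rewrite -subr_ge0 width mulr_ge0// subr_ge0.
rewrite lee_fin det_diag normr_prod /box_vol -big_split/=.
by rewrite le_eqVlt; apply/orP; left; apply/eqP/eq_bigr => l _; rewrite width.
Qed.

Definition upd k (x : 'cV[R]_k) i v : 'cV[R]_k := \col_l if l == i then v else x l ord0.

Definition sides_but k (i j : 'I_k) (a b : 'cV[R]_k) :=
  \prod_(l < k | (l != i) && (l != j)) (b l ord0 - a l ord0).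

Lemma box_volD2 k (i j : 'I_k) (a b : 'cV[R]_k) : i != j -> box_vol a b =
  (b i ord0 - a i ord0) * ((b j ord0 - a j ord0) * sides_but i j a b).
Proof. by move=> ij; rewrite (box_volD1 i) (bigD1 j)//= eq_sym. Qed.

(* Halving the box along the j-th axis halves the overshoot of the bounding boxes. *)
Lemma shear_halving k (M : 'M[R]_k.+1) i j t : i != j ->
  (forall (x : 'cV[R]_k.+1) l, (M *m x) l ord0 = x l ord0 + (l == i)%:R * (t * x j ord0)) ->
  forall n (a b : 'cV[R]_k.+1), (forall l, a l ord0 <= b l ord0) ->
  (vol (mulmx M @` box a b) <= (box_vol a b +
     `|t| * (b j ord0 - a j ord0) ^+ 2 * sides_but i j a b / 2 ^+ n)%:E)%E.
Proof.
move=> ij actM; elim=> [|n IHn] a b ab.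
  (* Without halving, the image fits in the box whose i-th side is lengthened by the range of t x_j,
     an interval of length |t| (b_j - a_j). *)
  pose m := Num.min (t * a j ord0) (t * b j ord0).
  pose m' := Num.max (t * a j ord0) (t * b j ord0).
  have width : m' - m = `|t| * (b j ord0 - a j ord0).
    exact: max_sub_min.
  pose a' := upd a i (a i ord0 + m); pose b' := upd b i (b i ord0 + m').
  apply: (@le_trans _ _ (vol (box a' b'))).
    apply: le_vol => _ [x xab <-] l; rewrite actM !mxE.
    have /andP[al bl] := xab l; case: eqP => [->|_]; last first.
      by rewrite mul0r addr0 al bl.
    have /andP[ai bi] := xab i; have /andP[aj bj] := xab j.
    rewrite mul1r !lerD//.
      rewrite /m' le_max; case: (leP 0 t) => [t0|/ltW t0].
        by rewrite (ler_wpM2l t0 bj) orbT.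
      by rewrite (ler_wnM2l t0 aj).
    rewrite /m ge_min; case: (leP 0 t) => [t0|/ltW t0].
      by rewrite (ler_wpM2l t0 aj).
    by rewrite (ler_wnM2l t0 bj) orbT.
  have wi : b' i ord0 - a' i ord0 =
      (b i ord0 - a i ord0) + `|t| * (b j ord0 - a j ord0).
    by rewrite !mxE eqxx -width; ring.
  have wl l : l != i -> b' l ord0 - a' l ord0 = b l ord0 - a l ord0.
    by rewrite !mxE => /negbTE ->.
  apply: (le_trans (vol_box _)) => [l|].
    rewrite -subr_ge0; case: (eqVneq l i) => [->|/wl ->]; last by rewrite subr_ge0.
    by rewrite wi addr_ge0 ?mulr_ge0 ?subr_ge0.
  have -> : box_vol a' b' = (b' i ord0 - a' i ord0) *
      ((b j ord0 - a j ord0) * sides_but i j a b).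
    rewrite (box_volD2 _ _ ij) (wl j) 1?eq_sym//; congr (_ * (_ * _)).
    by apply: eq_bigr => l /andP[/wl].
  rewrite lee_fin wi (box_volD2 _ _ ij) expr0 divr1.
  by rewrite le_eqVlt; apply/orP; left; apply/eqP; ring.
pose mid := (a j ord0 + b j ord0) / 2.
have mid_ab : a j ord0 <= mid <= b j ord0.
  by rewrite /mid; have := ab j; move: (a j ord0) (b j ord0) => u v uv; lra.
have [am mb] := andP mid_ab.
have split_box : mulmx M @` box a b `<=`
    (mulmx M @` box a (upd b j mid)) `|` (mulmx M @` box (upd a j mid) b).
  move=> _ [x xab <-]; case: (leP (x j ord0) mid) => xm; [left|right];
    exists x => // l; rewrite mxE; have := xab l; case: eqP => // ->.
    by move=> /andP[-> _].
  by move=> /andP[_ ->]; rewrite ltW.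
have rest_updr v : sides_but i j a (upd b j v) = sides_but i j a b.
  by apply: eq_bigr => l /andP[_ /negbTE lj]; rewrite !mxE lj.
have rest_updl v : sides_but i j (upd a j v) b = sides_but i j a b.
  by apply: eq_bigr => l /andP[_ /negbTE lj]; rewrite !mxE lj.
apply: (le_trans (le_vol split_box)); apply: (le_trans (vol_setU _ _)).
have ab1 l : a l ord0 <= upd b j mid l ord0 by rewrite mxE; case: eqP => // ->.
have ab2 l : upd a j mid l ord0 <= b l ord0 by rewrite mxE; case: eqP => // ->.
apply: (le_trans (leeD (IHn _ _ ab1) (IHn _ _ ab2))).
(* Each half has a quarter of the squared j-th side, and there are two halves, so the error term
   gains a factor 1/2. *)
rewrite -EFinD lee_fin !(box_volD2 _ _ ij) rest_updl rest_updr !mxE eqxx (negbTE ij).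
have pow2 : (2 ^+ n : R) != 0 by rewrite expf_neq0// pnatr_eq0.
rewrite le_eqVlt; apply/orP; left; apply/eqP.
by rewrite [2 ^+ n.+1]exprS /mid; field; rewrite pow2.
Qed.

(** The error term of [shear_halving] tends to 0 as the number of halvings grows. The shear is
    described by its action on coordinates, so that block matrices can be fed in directly. *)
Lemma lin_bounded_shear k (M : 'M[R]_k.+1) i j t : i != j -> \det M = 1 ->
  (forall (x : 'cV[R]_k.+1) l, (M *m x) l ord0 = x l ord0 + (l == i)%:R * (t * x j ord0)) ->
  lin_bounded M.
Proof.
move=> ij detM actM; apply: lin_bounded_box => [|a b ab].
  by rewrite detM oner_neq0.
rewrite detM normr1 mul1r; apply/lee_addgt0Pr => e e0.
pose C := `|t| * (b j ord0 - a j ord0) ^+ 2 * sides_but i j a b.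
have C0 : 0 <= C.
  apply: mulr_ge0; first by rewrite mulr_ge0 ?sqr_ge0.
  apply: prodr_ge0 => l _.
  by rewrite subr_ge0.
have [n Cn] : exists n, C / 2 ^+ n <= e.
  (* For this n one has 2^n > n > C / e. *)
  exists (Num.trunc (C / e)).+1.
  rewrite ler_pdivrMr ?exprn_gt0// mulrC -ler_pdivrMr//.
  apply: (@le_trans _ _ ((Num.trunc (C / e)).+1%:R)); first exact/ltW/truncnS_gt.
  by rewrite -natrX ler_nat ltnW// ltn_expl.
apply: (le_trans (shear_halving ij actM n ab)).
by rewrite -EFinD lee_fin lerD2l.
Qed.

Lemma mulmx_ublock k (x : 'cV[R]_(1 + k)) (r : 'rV[R]_k) (M : 'M[R]_k) :
  block_mx 1%:M r 0 M *m x = col_mx (usubmx x + r *m dsubmx x) (M *m dsubmx x).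
Proof. by rewrite -{1}[x]vsubmxK mul_block_col mul1mx mul0mx add0r. Qed.

Lemma mulmx_lblock k (x : 'cV[R]_(1 + k)) (c : 'cV[R]_k) (M : 'M[R]_k) :
  block_mx 1%:M 0 c M *m x = col_mx (usubmx x) (c *m usubmx x + M *m dsubmx x).
Proof. by rewrite -{1}[x]vsubmxK mul_block_col mul1mx mul0mx addr0. Qed.

Lemma delta_mulE m n (i : 'I_m) (j : 'I_n) (t : R) (x : 'cV[R]_n) l :
  ((t *: delta_mx i j) *m x) l ord0 = (l == i)%:R * (t * x j ord0).
Proof.
rewrite -scalemxAl !mxE (bigD1 j)//= big1 => [|p pj]; last first.
  by rewrite mxE (negbTE pj) andbF mul0r.
by rewrite mxE eqxx andbT addr0 mulrCA.
Qed.

(* [lin_bounded_shear] with its size in the form [1 + k] expected by block matrices. *)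
Lemma lin_bounded_block_shear k (M : 'M[R]_(1 + k)) (i j : 'I_(1 + k)) t :
  i != j -> \det M = 1 ->
  (forall (x : 'cV[R]_(1 + k)) l,
     (M *m x) l ord0 = x l ord0 + (l == i)%:R * (t * x j ord0)) ->
  lin_bounded M.
Proof. exact: lin_bounded_shear. Qed.

(** Multiplying two such block matrices adds their rows [r], so [r] may be split into its entries,
    each of which gives an elementary shear. *)
Lemma lin_bounded_row_shear k (r : 'rV[R]_k) :
  lin_bounded (block_mx 1%:M r 0 1%:M : 'M[R]_(1 + k)).
Proof.
rewrite [r]matrix_sum_delta big_ord1.
apply: (big_ind (fun r => lin_bounded (block_mx 1%:M r 0 1%:M : 'M[R]_(1 + k)))).
- rewrite -scalar_mx_block; apply: lin_bounded_box => [|a b ab].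
    by rewrite det1 oner_neq0.
  rewrite det1 normr1 mul1r; apply: le_trans (vol_box ab); apply: le_vol.
  by move=> _ [x xab <-]; rewrite mul1mx.
- move=> r1 r2 b1 b2; have := lin_bounded_mul b2 b1.
  by rewrite mulmx_block !mul1mx !mulmx1 !mul0mx !mulmx0 !addr0 !add0r.
move=> p _.
have detM : \det (block_mx 1%:M (r 0 p *: delta_mx 0 p) 0 1%:M : 'M[R]_(1 + k)) = 1.
  by rewrite det_ublock !det1 mulr1.
apply: (@lin_bounded_block_shear k _ (lshift k (ord0 : 'I_1)) (rshift 1 p) (r 0 p) _ detM).
  by rewrite eq_lrshift.
move=> x l; rewrite mulmx_ublock mul1mx.
have -> : x l ord0 = col_mx (usubmx x) (dsubmx x) l ord0 by rewrite vsubmxK.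
case: (split_ordP l) => q ->.
  by rewrite !col_mxEu [LHS]mxE delta_mulE (inj_eq (@lshift_inj _ _)) [dsubmx x _ _]mxE.
by rewrite !col_mxEd eq_rlshift mul0r addr0.
Qed.

Lemma lin_bounded_col_shear k (c : 'cV[R]_k) :
  lin_bounded (block_mx 1%:M 0 c 1%:M : 'M[R]_(1 + k)).
Proof.
rewrite [c]matrix_sum_delta; under eq_bigr do rewrite big_ord1.
apply: (big_ind (fun c => lin_bounded (block_mx 1%:M 0 c 1%:M : 'M[R]_(1 + k)))).
- rewrite -scalar_mx_block; apply: lin_bounded_box => [|a b ab].
    by rewrite det1 oner_neq0.
  rewrite det1 normr1 mul1r; apply: le_trans (vol_box ab); apply: le_vol.
  by move=> _ [x xab <-]; rewrite mul1mx.
- move=> r1 r2 b1 b2; have := lin_bounded_mul b1 b2.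
  by rewrite mulmx_block !mul1mx !mulmx1 !mul0mx !mulmx0 !addr0 !add0r.
move=> p _.
have detM : \det (block_mx 1%:M 0 (c p 0 *: delta_mx p 0) 1%:M : 'M[R]_(1 + k)) = 1.
  by rewrite det_lblock !det1 mulr1.
apply: (@lin_bounded_block_shear k _ (rshift 1 p) (lshift k (ord0 : 'I_1)) (c p 0) _ detM).
  by rewrite eq_rlshift.
move=> x l; rewrite mulmx_lblock mul1mx.
have -> : x l ord0 = col_mx (usubmx x) (dsubmx x) l ord0 by rewrite vsubmxK.
case: (split_ordP l) => q ->.
  by rewrite !col_mxEu eq_lrshift mul0r addr0.
by rewrite !col_mxEd [LHS]mxE delta_mulE (inj_eq (@rshift_inj _ _)) [usubmx x _ _]mxE addrC.
Qed.

(** The image of a box is the product of its first side with the image under [M] of the remaining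
    box; every nearly optimal cover of the latter is multiplied by that first side. *)
Lemma lin_bounded_block k (M : 'M[R]_k.+1) : lin_bounded M ->
  lin_bounded (block_mx 1%:M 0 0 M : 'M[R]_(1 + k.+1)).
Proof.
move=> [M0 bM]; apply: lin_bounded_box => [|a b ab].
  by rewrite det_ublock det1 mul1r.
rewrite det_ublock det1 mul1r.
pose a' := dsubmx (a : 'cV_(1 + k.+1)); pose b' := dsubmx (b : 'cV_(1 + k.+1)).
have ab' l : a' l ord0 <= b' l ord0 by rewrite !mxE; exact: ab.
pose w := b (lshift _ ord0) ord0 - a (lshift _ ord0) ord0.
have w0 : 0 <= w by rewrite subr_ge0.
have volE : box_vol a b = w * box_vol a' b'.
  rewrite /box_vol (@big_split_ord _ _ _ 1 k.+1)/= big_ord1; congr (_ * _).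
  by apply: eq_bigr => l _; rewrite !mxE.
have volM' : (vol (mulmx M @` box a' b') <= (`|\det M| * box_vol a' b')%:E)%E.
  apply: (le_trans (bM _)); rewrite EFinM lee_wpmul2l//; exact: vol_box.
apply/lee_addgt0Pr => e e0.
(* The slack is multiplied by the width [w], and w d <= e; adding 1 keeps the quotient meaningful
   when w = 0. *)
pose d := e / (w + 1).
have d0 : 0 < d by rewrite divr_gt0// ltr_wpDl.
have : (vol (mulmx M @` box a' b') < (`|\det M| * box_vol a' b' + d)%:E)%E.
  by apply: (le_lt_trans volM'); rewrite lte_fin ltrDl.
move=> /vol_lt_cover[p [q [[pq cov] /ltW lt_pq]]].
pose ext (u : 'cV[R]_(1 + k.+1)) (v : 'cV[R]_k.+1) : 'cV[R]_(1 + k.+1) :=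
  col_mx (usubmx u) v.
have ext_vol j : box_vol (ext a (p j)) (ext b (q j)) = w * box_vol (p j) (q j).
  rewrite /box_vol (@big_split_ord _ _ _ 1 k.+1)/= big_ord1.
  rewrite !col_mxEu [usubmx a _ _]mxE [usubmx b _ _]mxE; congr (_ * _).
  by apply: eq_bigr => l _; rewrite !col_mxEd.
have cov' : box_cover (mulmx (block_mx 1%:M 0 0 M : 'M[R]_(1 + k.+1)) @` box a b)
    (fun j => ext a (p j)) (fun j => ext b (q j)).
  split=> [j l|_ [x xab <-]].
    case: (split_ordP l) => s ->; last by rewrite !col_mxEd.
    by rewrite !col_mxEu !mxE.
  have [|j _ xj] := cov (M *m dsubmx (x : 'cV_(1 + k.+1))).
    by exists (dsubmx (x : 'cV_(1 + k.+1))) => // l; rewrite !mxE; exact: xab.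
  exists j => // l; rewrite mulmx_ublock mul0mx addr0.
  case: (split_ordP l) => s ->; last by rewrite !col_mxEd; exact: xj.
  by rewrite !col_mxEu !mxE; exact: xab.
apply: (le_trans (vol_le_cover cov')).
under eq_eseriesr do rewrite ext_vol EFinM.
rewrite nneseriesZl; last by move=> j _; rewrite lee_fin box_vol_ge0.
apply: (@le_trans _ _ (w%:E * (`|\det M| * box_vol a' b' + d)%:E)%E).
  by rewrite lee_wpmul2l.
rewrite -EFinM -EFinD lee_fin volE mulrDr mulrCA lerD2l /d.
rewrite mulrA ler_pdivrMr ?ltr_wpDl// mulrC ler_wpM2l ?(ltW e0)//.
by rewrite lerDl.
Qed.

(** Gaussian elimination by induction on the size: a transposition brings a nonzero pivot to the
    corner, and the matrix then factors into a column shear, a diagonal matrix, a smaller block and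
    a row shear. *)
Lemma lin_bounded_unit k (M : 'M[R]_k.+1) : \det M != 0 -> lin_bounded M.
Proof.
elim: k M => [|k IHk] M M0.
  have -> : M = diag_mx (const_mx (M 0 0)).
    by apply/matrixP => i j; rewrite !mxE !ord1 eqxx.
  apply: lin_bounded_diag => i; rewrite mxE.
  by move: M0; rewrite det_mx11.
have pivoted (N : 'M[R]_(1 + k.+1)) : \det N != 0 -> N 0 0 != 0 -> lin_bounded N.
  move=> N0 piv; set a := N 0 0 in piv.
  pose r : 'rV[R]_k.+1 := a^-1 *: ursubmx N; pose c : 'cV[R]_k.+1 := a^-1 *: dlsubmx N.
  (* The Schur complement of the pivot; its determinant is nonzero because that of [N] is, so the
     induction hypothesis applies to it. *)
  pose S : 'M[R]_k.+1 := drsubmx N - a *: (c *m r).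
  pose d : 'rV[R]_(1 + k.+1) := row_mx a%:M (const_mx 1).
  have NE : N = block_mx 1%:M 0 c 1%:M *m (diag_mx d *m
      (block_mx 1%:M 0 0 S *m block_mx 1%:M r 0 1%:M)).
    rewrite diag_mx_row diag_const_mx; rewrite !mulmx_block.
    rewrite !(mul1mx, mulmx1, mul0mx, mulmx0, addr0, add0r).
    have -> : diag_mx (a%:M : 'rV[R]_1) = a%:M.
      by apply/matrixP => i j; rewrite !mxE !ord1.
    rewrite -[LHS]submxK; congr block_mx.
    - by apply/matrixP => i j; rewrite !ord1 !mxE mulr1n /a; congr (N _ _); exact: val_inj.
    - by rewrite /r mul_scalar_mx scalerA divff// scale1r.
    - by rewrite /c mul_mx_scalar scalerA divff// scale1r.
    - by rewrite mul_scalar_mx -scalemxAr addrC subrK.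
  have d0 i : d ord0 i != 0.
    case: (split_ordP i) => l ->; first by rewrite row_mxEl mxE !ord1 mulr1n.
    by rewrite row_mxEr mxE oner_neq0.
  have S0 : \det S != 0.
    apply: contra_neq N0 => S0.
    by rewrite NE !det_mulmx det_ublock S0 !(mulr0, mul0r).
  rewrite NE; apply: lin_bounded_mul; first exact: lin_bounded_col_shear.
  apply: lin_bounded_mul; first exact: lin_bounded_diag.
  apply: lin_bounded_mul; last exact: lin_bounded_row_shear.
  exact/lin_bounded_block/IHk.
have [i Mi] : exists i, M i 0 != 0.
  apply/existsP; apply: contraNT M0 => /existsPn M_eq0.
  rewrite (expand_det_col _ 0) big1// => i _.
  by have /negPn/eqP -> := M_eq0 i; rewrite mul0r.
have -> : M = tperm_mx 0 i *m (tperm_mx 0 i *m M).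
  by rewrite mulmxA -perm_mxM tperm2 perm_mx1 mul1mx.
apply: lin_bounded_mul; first exact: lin_bounded_tperm.
have detP : \det (tperm_mx 0 i : 'M[R]_k.+2) != 0.
  by rewrite det_perm signr_eq0.
apply: pivoted; first by rewrite det_mulmx mulf_neq0.
by rewrite -xrowE mxE tpermL.
Qed.

(** The reverse inequality is the upper bound for the inverse matrix, applied to the image of
    [A]. *)
Lemma vol_linear k (M : 'M[R]_k.+1) (A : set 'cV[R]_k.+1) : \det M != 0 ->
  vol (mulmx M @` A) = (`|\det M|%:E * vol A)%E.
Proof.
move=> M0; apply/eqP; rewrite eq_le (lin_bounded_unit M0).2/=.
have Mu : M \in unitmx by rewrite unitmxE unitfE.
have V0 : \det (invmx M) != 0 by rewrite det_inv invr_eq0.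
have := (lin_bounded_unit V0).2 (mulmx M @` A).
rewrite image_comp (_ : (mulmx (invmx M) \o mulmx M) @` A = A); last first.
  rewrite -[RHS]image_id; apply: eq_imagel => x _ /=.
  by rewrite mulmxA mulVmx// mul1mx.
by rewrite det_inv normfV -lee_pdivrMl ?normr_gt0// ?invr_gt0 ?normr_gt0 ?invrK.
Qed.

End LinearScaling.

(** * Volume of a box *)

Section BoxVolume.
Context {R : realType}.

Lemma lebesgue_measure_cc (a b : R) : a <= b ->
  @lebesgue_measure R `[a, b]%classic = (b - a)%:E.
Proof.
move=> ab; rewrite lebesgue_measure_itv/= lte_fin; case: ltP => // ba.
by have -> : a = b by [apply/le_anti/andP; split]; rewrite subrr.
Qed.

(* Induction on the dimension: slicing along the first axis gives the inequality
   fibrewise, and it is then integrated along that axis. *)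
Lemma box_vol_le_series k (a0 b0 : 'I_k -> R) (a b : nat -> 'I_k -> R) (P : pred nat) :
  (forall i, a0 i <= b0 i) -> (forall j i, a j i <= b j i) ->
  (forall x, (forall i, a0 i <= x i <= b0 i) ->
     exists2 j, P j & forall i, a j i <= x i <= b j i) ->
  ((\prod_i (b0 i - a0 i))%:E <=
   \sum_(0 <= j <oo) ((P j)%:R * \prod_i (b j i - a j i))%:E)%E.
Proof.
elim: k a0 b0 a b P => [|k IHk] a0 b0 a b P ab0 ab cov.
  (* In dimension 0 the left side is 1, and covering the only point forces at least one selected
     box, which contributes 1. *)
  have [|j Pj _] := cov (fun=> 0); first by case.
  rewrite big_ord0 (nneseriesD1 (n := j))//; last first.
    by move=> l _; rewrite lee_fin big_ord0 mulr1 ler0n.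
  rewrite Pj big_ord0 mulr1 leeDl//; apply: nneseries_ge0 => l _ _.
  by rewrite lee_fin big_ord0 mulr1 ler0n.
pose c j := (P j)%:R * \prod_i (b j (lift ord0 i) - a j (lift ord0 i)).
have c_ge0 j : 0 <= c j.
  by rewrite mulr_ge0 ?ler0n//; apply: prodr_ge0 => i _; rewrite subr_ge0.
pose I : set R := `[a0 ord0, b0 ord0]%classic.
pose J j : set R := `[a j ord0, b j ord0]%classic.
pose V := \prod_i (b0 (lift ord0 i) - a0 (lift ord0 i)).
have mJ j : measurable (J j) by exact: measurable_itv.
have mI : measurable I by exact: measurable_itv.
have slice s : I s -> (V%:E <= \sum_(0 <= j <oo) (c j * \1_(J j) s)%:E)%E.
  (* [Q] keeps the selected boxes that meet the slice at height [s]. Carrying a predicate in the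
     induction avoids having to reindex the cover. *)
  move=> Is; pose Q j := P j && (a j ord0 <= s <= b j ord0).
  have covQ (x : 'I_k -> R) :
      (forall i, a0 (lift ord0 i) <= x i <= b0 (lift ord0 i)) ->
      exists2 j, Q j & forall i, a j (lift ord0 i) <= x i <= b j (lift ord0 i).
    move=> xab.
    have [|j Pj xj] := cov (fun i => if unlift ord0 i is Some i' then x i' else s).
      move=> i; case: unliftP => [i' ->|->]; first exact: xab.
      by move: Is; rewrite /I/= in_itv.
    exists j => [|i]; last by have := xj (lift ord0 i); rewrite liftK.
    by rewrite /Q Pj/=; have := xj ord0; rewrite unlift_none.
  apply: (le_trans (IHk _ _ _ _ Q (fun i => ab0 _) (fun j i => ab j _) covQ)).
  rewrite le_eqVlt; apply/orP; left; apply/eqP/eq_eseriesr => j _.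
  congr _%:E; rewrite /c indicE /Q -mulrA (mulrC (\prod_i _)) mulrA -natrM mulnb.
  by congr (_%:R * _); congr (_ && _ : nat); rewrite mem_setE in_itv.
pose f j (s : R) : \bar R := (c j * \1_(J j) s)%:E.
have mc j : measurable_fun I (f j).
  by apply/measurable_EFinP; apply: measurable_funM => //; exact: measurable_indic.
have V_le : (\int[@lebesgue_measure R]_(s in I) V%:E <=
    \int[@lebesgue_measure R]_(s in I) \sum_(0 <= j <oo) (c j * \1_(J j) s)%:E)%E.
  apply: ge0_le_integral => //.
  - by move=> s _; rewrite lee_fin; apply: prodr_ge0 => i _; rewrite subr_ge0.
  - apply: (@ge0_emeasurable_sum _ _ R I f xpredT) => [j s _ _|j _].
      by rewrite lee_fin mulr_ge0.
    exact: mc.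
have muI : lebesgue_measure I = (b0 ord0 - a0 ord0)%:E.
  exact: lebesgue_measure_cc.
have muJ j : lebesgue_measure (J j) = (b j ord0 - a j ord0)%:E.
  exact: lebesgue_measure_cc.
have intV : (\int[@lebesgue_measure R]_(s in I) V%:E = (V * (b0 ord0 - a0 ord0))%:E)%E.
  by rewrite integral_cst// EFinM; congr (_ * _)%E; exact: muI.
move: V_le; rewrite intV.
rewrite integral_nneseries//; last first.
  by move=> j s _; rewrite lee_fin mulr_ge0.
rewrite big_ord_recl mulrC => V_le; apply: (le_trans V_le).
apply: lee_nneseries => [j _ _|j _].
  by apply: integral_ge0 => s _; rewrite lee_fin mulr_ge0.
under eq_integral do rewrite EFinM.
rewrite ge0_integralZl_EFin//; last first.
  have mind : measurable_fun I (\1_(J j) : R -> R) by exact: measurable_indic.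
  exact/(measurable_EFinP I (\1_(J j) : R -> R)).
rewrite integral_indic//; last exact: mJ.
rewrite big_ord_recl mulrCA [leRHS]EFinM.
rewrite [leRHS]muleC lee_wpmul2l ?lee_fin//.
apply: (@le_trans _ _ (lebesgue_measure (J j))); last by rewrite muJ.
have mIJ : measurable (J j `&` I) by exact: measurableI.
apply: le_measure; rewrite ?inE; [exact: mIJ|exact: mJ|exact: subIsetl].
Qed.

Lemma vol_box_ge k (a b : 'cV[R]_k) : (forall i, a i ord0 <= b i ord0) ->
  ((box_vol a b)%:E <= vol (box a b))%E.
Proof.
move=> ab; apply: vol_ge => p q [pq cov].
have := @box_vol_le_series k (fun i => a i ord0) (fun i => b i ord0)
  (fun j i => p j i ord0) (fun j i => q j i ord0) predT ab pq.
under eq_eseriesr do rewrite mul1r.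
apply=> x xab; have [|j _ xj] := cov (\col_i x i); first by move=> i; rewrite mxE.
by exists j => // i; have := xj i; rewrite mxE.
Qed.

End BoxVolume.

(** * Hadamard's inequality *)

Section Hadamard.
Context {R : realType}.

Lemma gramE m n (M : 'M[R]_(m, n)) i : (M *m M^T) i i = \sum_j M i j ^+ 2.
Proof. by rewrite mxE; apply: eq_bigr => j _; rewrite mxE. Qed.

Lemma gram_ge0 m n (M : 'M[R]_(m, n)) i : 0 <= (M *m M^T) i i.
Proof. by rewrite gramE; apply: sumr_ge0 => j _; exact: sqr_ge0. Qed.

(* Householder reflection in the direction of [x - |x| e_0]. *)
Lemma rotate_to_axis n (x : 'rV[R]_(1 + n)) : exists H : 'M[R]_(1 + n),
  H *m H^T = 1%:M /\ rsubmx (x *m H) = 0.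
Proof.
pose s := Num.sqrt ((x *m x^T) 0 0).
have s2 : s ^+ 2 = (x *m x^T) 0 0 by rewrite sqr_sqrtr ?gram_ge0.
pose e : 'rV[R]_(1 + n) := row_mx 1%:M 0; pose v := x - s *: e.
have [v0|v_neq0] := eqVneq v 0.
  exists 1%:M; rewrite trmx1 mulmx1 mulmx1; split=> //.
  by move/subr0_eq: v0 => ->; rewrite linearZ/= row_mxKr scaler0.
pose q := (v *m v^T) 0 0.
have q0 : q != 0.
  apply: contra_neq v_neq0; rewrite /q gramE => /eqP.
  rewrite psumr_eq0 => [/allP v0|j _]; last exact: sqr_ge0.
  apply/rowP => j; rewrite [RHS]mxE; apply/eqP; rewrite -sqrf_eq0.
  by apply: v0; rewrite mem_index_enum.
have vvT : v *m v^T = q%:M by rewrite [LHS]mx11_scalar.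
have eeT : e *m e^T = 1%:M.
  by rewrite tr_row_mx mul_row_col trmx0 mulmx0 addr0 trmx1 mulmx1.
have xeT : x *m e^T = e *m x^T.
  by rewrite -[LHS]trmxK trmx_mul trmxK [LHS]mx11_scalar [RHS]mx11_scalar mxE.
have xxT : x *m x^T = (s ^+ 2)%:M by rewrite [LHS]mx11_scalar s2.
(* Since x and s e have the same norm, |v|^2 = 2 <x, v>; hence the reflection subtracts exactly [v]
   from [x] and leaves s e. *)
have xvT : x *m v^T = (q / 2)%:M.
  have : v *m v^T = 2 *: (x *m v^T).
    rewrite {1}/v mulmxBl -scalemxAl /v linearB/= linearZ/= !mulmxBr -!scalemxAr.
    rewrite eeT xeT xxT.
    apply/matrixP => i j; rewrite !mxE !ord1/= !mulr1n; ring.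
  rewrite vvT => qE; apply: (scalerI (_ : 2 != 0 :> R)); first by rewrite pnatr_eq0.
  by rewrite -qE scale_scalar_mx mulrC divfK// pnatr_eq0.
have xv : x - v = s *: e by rewrite opprB addrC subrK.
clearbody v; pose H : 'M[R]_(1 + n) := 1%:M - (2 / q) *: (v^T *m v).
have HT : H^T = H.
  by rewrite /H linearB/= linearZ/= trmx1 trmx_mul trmxK.
exists H; rewrite HT; split.
  rewrite /H mulmxBl mul1mx -scalemxAl mulmxBr mulmx1 -scalemxAr.
  rewrite mulmxA -(mulmxA v^T) vvT mul_mx_scalar -scalemxAl.
  apply/matrixP => i j; rewrite !mxE; move: (_ == _) (\sum_(_ < _) _) => b z.
  by field.
rewrite /H mulmxBr mulmx1 -scalemxAr mulmxA xvT mul_scalar_mx scalerA.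
have -> : 2 / q * (q / 2) = 1 by field.
by rewrite scale1r xv linearZ/= row_mxKr scaler0.
Qed.

(** An orthogonal [H] moves the first row onto the first axis and keeps the Gram matrix. The product
    is then block lower triangular, and the induction hypothesis applies to its lower right block,
    whose squared row norms are at most those of the full rows. *)
Lemma hadamard n (M : 'M[R]_n) : (\det M) ^+ 2 <= \prod_i (M *m M^T) i i.
Proof.
elim: n M => [|n IHn] M; first by rewrite det_mx00 expr1n big_ord0.
have [H [HHT xH]] := rotate_to_axis (usubmx (M : 'M[R]_(1 + n, 1 + n))).
pose N : 'M[R]_(1 + n) := M *m H.
have NNT : N *m N^T = M *m M^T.
  by rewrite trmx_mul mulmxA -(mulmxA M) HHT mulmx1.
have detN : (\det N) ^+ 2 = (\det M) ^+ 2.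
  have : (\det H) ^+ 2 = 1 by rewrite expr2 -{2}det_tr -det_mulmx HHT det1.
  by rewrite /N det_mulmx exprMn => ->; rewrite mulr1.
have NE : N = block_mx (ulsubmx N) 0 (dlsubmx N) (drsubmx N).
  rewrite -{1}[N]submxK; congr block_mx.
  by rewrite -xH /ursubmx /N -mul_usub_mx.
have NNTE : N *m N^T = block_mx (ulsubmx N *m (ulsubmx N)^T)
    (ulsubmx N *m (dlsubmx N)^T) (dlsubmx N *m (ulsubmx N)^T)
    (dlsubmx N *m (dlsubmx N)^T + drsubmx N *m (drsubmx N)^T).
  by rewrite {1 2}NE tr_block_mx mulmx_block trmx0 mulmx0 mul0mx !addr0 mulmx0 addr0.
have entry0 : (N *m N^T) (lshift n 0) (lshift n 0) = ulsubmx N 0 0 ^+ 2.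
  by rewrite NNTE block_mxEul gramE big_ord1.
have entry i : (N *m N^T) (rshift 1 i) (rshift 1 i) =
    (dlsubmx N *m (dlsubmx N)^T) i i + (drsubmx N *m (drsubmx N)^T) i i.
  by rewrite NNTE block_mxEdr mxE.
have -> : \prod_i (M *m M^T) i i = ulsubmx N 0 0 ^+ 2 *
    \prod_i ((dlsubmx N *m (dlsubmx N)^T) i i + (drsubmx N *m (drsubmx N)^T) i i).
  rewrite -NNT (@big_split_ord _ _ _ 1 n)/= big_ord1; congr (_ * _); first exact: entry0.
  by apply: eq_bigr => i _; exact: entry.
have detE : \det N = ulsubmx N 0 0 * \det (drsubmx N).
  by rewrite {1}NE det_lblock det_mx11.
rewrite -detN detE exprMn; apply: ler_wpM2l; first exact: sqr_ge0.
apply: (le_trans (IHn _)); apply: ler_prod => i _.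
by rewrite gram_ge0/= lerDr gram_ge0.
Qed.

End Hadamard.

(** * The hull of a basis and one more vector *)

Section Median.
Context {R : realType}.
Implicit Types b c e r : R.

(** The weighted sum of distances to the three points decreases towards b2 with slope at least c2 +
    c3 - c1 from the left and c1 + c2 - c3 from the right. Both are at least [e], so stopping at b2
    rather than at [r] saves at least e |b2 - r|. *)
Lemma weighted_median c1 c2 c3 b1 b2 b3 e r :
  0 <= c1 -> 0 <= c2 -> 0 <= c3 -> b1 <= b2 -> b2 <= b3 ->
  e + c1 <= c2 + c3 -> e + c3 <= c1 + c2 ->
  c1 * `|b1 - b2| + c3 * `|b3 - b2| + e * `|b2 - r| <=
  c1 * `|b1 - r| + c2 * `|b2 - r| + c3 * `|b3 - r|.
Proof.
move=> c1_ge0 c2_ge0 c3_ge0 b12 b23 e1 e3.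
rewrite (ler0_norm (x := b1 - b2)) ?subr_le0// (ger0_norm (x := b3 - b2)) ?subr_ge0//.
have [h|/ltW h] := leP 0 (b2 - r).
  have n3 : c3 * (b3 - r) <= c3 * `|b3 - r| by rewrite ler_wpM2l// ler_norm.
  have n1 : c1 * (r - b1) <= c1 * `|b1 - r|.
    by rewrite ler_wpM2l// distrC ler_norm.
  have : e * (b2 - r) <= (c2 + c3 - c1) * (b2 - r) by rewrite ler_wpM2r//; lra.
  by rewrite (ger0_norm h); lra.
have n3 : c3 * (b3 - r) <= c3 * `|b3 - r| by rewrite ler_wpM2l// ler_norm.
have n1 : c1 * (r - b1) <= c1 * `|b1 - r|.
  by rewrite ler_wpM2l// distrC ler_norm.
have h' : 0 <= r - b2 by rewrite -oppr_le0 opprB.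
have : e * (r - b2) <= (c1 + c2 - c3) * (r - b2) by apply: ler_wpM2r => //; lra.
by rewrite (ler0_norm h); lra.
Qed.

Definition same_sign (x y : R) := (0 <= x /\ 0 <= y) \/ (x <= 0 /\ y <= 0).

(* The convex function [s |-> |s| + |p - s a| + |q - s b|] is minimal at the median
   of its three breakpoints [0], [p / a] and [q / b]. *)
Lemma median_cost (p q a b e r : R) : 0 < a -> 0 < b ->
  e + 1 <= a + b -> e + a <= 1 + b -> e + b <= 1 + a ->
  exists s, `|s| + `|p - s * a| + `|q - s * b| + e * `|s - r| <=
            `|r| + `|p - r * a| + `|q - r * b| /\
   [\/ s = 0 /\ same_sign (- p) q,
       p = s * a /\ same_sign s (q - s * b) |
       q = s * b /\ same_sign s (p - s * a)].
Proof.
move=> a_gt0 b_gt0 e1 ea eb.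
have [u pE] : exists u, p = u * a by exists (p / a); rewrite divfK// gt_eqF.
have [w qE] : exists w, q = w * b by exists (q / b); rewrite divfK// gt_eqF.
have normp s : `|p - s * a| = a * `|u - s|.
  by rewrite pE -mulrBl normrM (gtr0_norm a_gt0) mulrC.
have normq s : `|q - s * b| = b * `|w - s|.
  by rewrite qE -mulrBl normrM (gtr0_norm b_gt0) mulrC.
have norms (s : R) : `|s| = 1 * `|0 - s| by rewrite mul1r sub0r normrN.
have a0 := ltW a_gt0; have b0 := ltW b_gt0; have one0 : (0 : R) <= 1 := ler01.
have med0 (x y cx cy : R) : 0 <= cx -> 0 <= cy -> x <= 0 -> 0 <= y ->
    e + cx <= 1 + cy -> e + cy <= cx + 1 -> 
    cx * `|x - 0| + cy * `|y - 0| + e * `|0 - r| <=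
    1 * `|0 - r| + cx * `|x - r| + cy * `|y - r|.
  move=> cx0 cy0 x0 y0 h1 h2.
  have := @weighted_median cx 1 cy x 0 y e r cx0 one0 cy0 x0 y0 h1 h2; lra.
have opp (x c : R) : 0 < c -> x <= 0 -> x * c <= 0 by move=> /ltW c0 x0; exact: mulr_le0_ge0.
have pos (x c : R) : 0 < c -> 0 <= x -> 0 <= x * c by move=> /ltW c0 x0; exact: mulr_ge0.
(* The order of the breakpoints 0, u and w tells which of them is the median, to be taken as [s].
   The three hypotheses on [e] say that its slack is available whichever one it is. *)
have [u0|/ltW u0] := leP u 0; have [w0|/ltW w0] := leP w 0.
- have [uw|/ltW uw] := leP u w.
    exists w; split; last first.
      apply: Or33; split=> //; right; rewrite pE -mulrBl; split=> //.
      by apply: opp; rewrite ?subr_le0.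
    have := @weighted_median a b 1 u w 0 e r a0 b0 one0 uw w0 ltac:(lra) ltac:(lra).
    by rewrite !normp !normq (norms w) (norms r) subrr normr0; lra.
  exists u; split; last first.
    apply: Or32; split=> //; right; rewrite qE -mulrBl; split=> //.
    by apply: opp; rewrite ?subr_le0.
  have := @weighted_median b a 1 w u 0 e r b0 a0 one0 uw u0 ltac:(lra) ltac:(lra).
  by rewrite !normp !normq (norms u) (norms r) subrr normr0; lra.
- exists 0; split; last first.
    by apply: Or31; split=> //; left; rewrite oppr_ge0 pE qE; split; [exact: opp|exact: pos].
  have := med0 u w a b a0 b0 u0 w0 ltac:(lra) ltac:(lra).
  by rewrite !normp !normq (norms r) normr0; lra.
- exists 0; split; last first.
    by apply: Or31; split=> //; right; rewrite oppr_le0 pE qE; split; [exact: pos|exact: opp].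
  have := med0 w u b a b0 a0 w0 u0 ltac:(lra) ltac:(lra).
  by rewrite !normp !normq (norms r) normr0; lra.
have [uw|/ltW uw] := leP u w.
  exists u; split; last first.
    apply: Or32; split=> //; left; rewrite qE -mulrBl; split=> //.
    by apply: pos; rewrite ?subr_ge0.
  have := @weighted_median 1 a b 0 u w e r one0 a0 b0 u0 uw ltac:(lra) ltac:(lra).
  by rewrite !normp !normq (norms u) (norms r) subrr normr0; lra.
exists w; split; last first.
  apply: Or33; split=> //; left; rewrite pE -mulrBl; split=> //.
  by apply: pos; rewrite ?subr_ge0.
have := @weighted_median 1 b a 0 w u e r one0 b0 a0 w0 uw ltac:(lra) ltac:(lra).
by rewrite !normp !normq (norms w) (norms r) subrr normr0; lra.
Qed.

End Median.

(** * Covering the hull by linear images of wedges *)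

Section Pieces.
Context {R : realType}.

Definition l1 k (x : 'cV[R]_k) : R := \sum_i `|x i ord0|.

Lemma sym_hull_image n k (S : 'M[R]_(k, n)) :
  sym_hull S `<=` mulmx S @` [set z | l1 z <= 1].
Proof.
move=> x [lam [mu [lam0 mu0 sum1 ->]]]; exists (\col_i (lam i - mu i)) => /=.
  rewrite /l1 -sum1 -big_split/=; apply: ler_sum => i _; rewrite mxE.
  by apply: (le_trans (ler_normB _ _)); rewrite !ger0_norm.
apply/matrixP => i j; rewrite !mxE summxE; apply: eq_bigr => l _.
by rewrite !mxE; ring.
Qed.

Lemma image_sym_hull n k (S : 'M[R]_(k, n)) : (0 < n)%N ->
  mulmx S @` [set z | l1 z <= 1] `<=` sym_hull S.
Proof.
move=> n_gt0 _ [z /= z1 <-].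
(* The weights of a convex combination must sum to 1, so the missing mass is shared equally by all
   2n vectors, where it cancels in opposite pairs. The rest is the positive and negative part of
   [z]. *)
pose d := (1 - l1 z) / (2 * n%:R).
have n0 : n%:R != 0 :> R by rewrite pnatr_eq0 -lt0n.
have d0 : 0 <= d by rewrite divr_ge0 ?subr_ge0// mulr_ge0.
exists (fun i => (`|z i ord0| + z i ord0) / 2 + d).
exists (fun i => (`|z i ord0| - z i ord0) / 2 + d); split.
- by move=> i; rewrite addr_ge0// divr_ge0// -[X in _ + X]opprK subr_ge0 -normrN ler_norm.
- by move=> i; rewrite addr_ge0// divr_ge0// subr_ge0 ler_norm.
- rewrite -big_split/= (eq_bigr (fun i => `|z i ord0| + 2 * d)) => [|i _]; last first.
    by field.
  rewrite big_split/= -/(l1 z) sumr_const card_ord -mulr_natr /d.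
  by field.
apply/matrixP => i j; rewrite !mxE summxE; apply: eq_bigr => l _.
by rewrite !mxE ord1; field.
Qed.

Lemma vol_opp k (A : set 'cV[R]_k.+1) : vol (-%R @` A) = vol A.
Proof.
have detN1 : `|\det (- 1%:M : 'M[R]_k.+1)| = 1.
  by rewrite -scaleN1r detZ det1 mulr1 normrX normrN1 expr1n.
rewrite (_ : -%R @` A = mulmx (- 1%:M) @` A).
  by rewrite vol_linear ?detN1 ?mul1e// -normr_gt0 detN1.
by apply: eq_imagel => x _; rewrite mulNmx mul1mx.
Qed.

Lemma vol_linear_symm_le k (M : 'M[R]_k.+1) (A : set 'cV[R]_k.+1) : \det M != 0 ->
  (vol (mulmx M @` (A `|` -%R @` A)) <= `|\det M|%:E * (vol A + vol A))%E.
Proof.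
move=> M0; rewrite vol_linear// lee_wpmul2l//; apply: (le_trans (vol_setU _ _)).
by rewrite vol_opp.
Qed.

(** This sends the j-th basis vector to [v] and fixes the others, so it carries cells of the
    standard cross-polytope to cells of the hull that use [v] in place of that vector. *)
Definition repl_col k (j : 'I_k) (v : 'cV[R]_k) : 'M[R]_k :=
  \matrix_(a, b) if b == j then v a ord0 else (a == b)%:R.

Lemma repl_colE k (j : 'I_k) (v x : 'cV[R]_k) l :
  (repl_col j v *m x) l ord0 = (if l == j then 0 else x l ord0) + v l ord0 * x j ord0.
Proof.
rewrite mxE (bigD1 j)//= mxE eqxx addrC; congr (_ + _).
have [->|lj] := eqVneq l j.
  by apply: big1 => i ij; rewrite mxE (negbTE ij) eq_sym (negbTE ij) mul0r.
rewrite (bigD1 l)//= mxE (negbTE lj) eqxx mul1r big1 ?addr0// => i /andP[ij il].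
by rewrite mxE (negbTE ij) eq_sym (negbTE il) mul0r.
Qed.

Lemma det_repl_col k (j : 'I_k) (v : 'cV[R]_k) : \det (repl_col j v) = v j ord0.
Proof.
rewrite (expand_det_row _ j) (bigD1 j)//= big1 ?addr0 => [|i ij]; last first.
  by rewrite mxE (negbTE ij) eq_sym (negbTE ij) mul0r.
rewrite mxE eqxx /cofactor (_ : row' _ _ = 1%:M); last first.
  apply/matrixP => a b; rewrite !mxE eq_sym (negbTE (neq_lift _ _)).
  by rewrite (inj_eq lift_inj).
by rewrite det1 addnn -signr_odd odd_double mulr1 mulr1.
Qed.

Section TwoAxes.
Variables (k : nat) (i0 i1 : 'I_k.+1).
Hypothesis i01 : i0 != i1.

Definition wedge : set 'cV[R]_k.+1 :=
  [set x : 'cV[R]_k.+1 | [/\ 0 <= x i0 ord0, 0 <= x i1 ord0 & l1 x <= 1]].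

Definition wedges := wedge `|` -%R @` wedge.

(* The symmetric hull of the standard basis together with [v]. *)
Definition hull_with (v : 'cV[R]_k.+1) : set 'cV[R]_k.+1 :=
  [set x : 'cV[R]_k.+1 | exists r, `|r| + l1 (x - r *: v) <= 1].

Definition off_axes (x : 'cV[R]_k.+1) : R :=
  \sum_(l < k.+1 | (l != i0) && (l != i1)) `|x l ord0|.

Lemma l1D2 (x : 'cV[R]_k.+1) : l1 x = `|x i0 ord0| + (`|x i1 ord0| + off_axes x).
Proof. by rewrite /l1 (bigD1 i0)//= (bigD1 i1) 1?eq_sym. Qed.

Lemma l1N (x : 'cV[R]_k.+1) : l1 (- x) = l1 x.
Proof. by apply: eq_bigr => i _; rewrite mxE normrN. Qed.

Lemma wedgesP (x : 'cV[R]_k.+1) : same_sign (x i0 ord0) (x i1 ord0) -> l1 x <= 1 -> wedges x.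
Proof.
move=> [] [x0 x1] xl1; [left|right]; first by split.
by exists (- x); rewrite ?opprK//; split; rewrite ?l1N// mxE oppr_ge0.
Qed.

(** The reflection in the i0-th coordinate, written with [repl_col] so that its action and
    determinant come from the same formulas. *)
Definition flip : 'M[R]_k.+1 := repl_col i0 (- delta_mx i0 ord0).

(** In cyclic order the hexagon has vertices e_0, v, e_1 and their opposites. In a representation of
    [x] by [v] and the basis, the coefficient [r] of [v] is replaced by the median [s] of
    [median_cost]. The cost off the two axes rises by at most [off_axes v] times |s - r|, which the
    slack pays for. Now one of v, e_0, e_1 has coefficient 0 and the other two coefficients have the
    signs of adjacent vertices; the three cases are the three pieces. *)
Lemma hull_with_cover (v : 'cV[R]_k.+1) :
  0 < v i0 ord0 -> 0 < v i1 ord0 ->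
  off_axes v + 1 <= v i0 ord0 + v i1 ord0 ->
  off_axes v + v i0 ord0 <= 1 + v i1 ord0 ->
  off_axes v + v i1 ord0 <= 1 + v i0 ord0 ->
  hull_with v `<=` (mulmx flip @` wedges) `|`
    ((mulmx (repl_col i0 v) @` wedges) `|` (mulmx (repl_col i1 v) @` wedges)).
Proof.
move=> v0 v1 e1 e0 e1' x [r xr].
have [s [cost_s sign_s]] := median_cost (x i0 ord0) (x i1 ord0) r v0 v1 e1 e0 e1'.
have off_s : off_axes (x - s *: v) <= off_axes (x - r *: v) + off_axes v * `|s - r|.
  rewrite (mulrC (off_axes v)) /off_axes mulr_sumr -big_split/=; apply: ler_sum => l _.
  have -> : (x - s *: v) l ord0 = (x - r *: v) l ord0 - (s - r) * v l ord0.
    by rewrite !mxE; ring.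
  by apply: (le_trans (ler_normB _ _)); rewrite normrM.
have xs : `|s| + l1 (x - s *: v) <= 1.
  apply: le_trans xr; rewrite !l1D2.
  have entry t i : (x - t *: v) i ord0 = x i ord0 - t * v i ord0 by rewrite !mxE.
  rewrite !entry; move: cost_s off_s.
  move: (off_axes _) (off_axes (x - r *: v)) (off_axes v) => o1 o2 o3.
  move: `|_| `|_| `|_| `|_| `|_| `|_| `|_| => n1 n2 n3 n4 n5 n6 n7; lra.
have entry i : (x - s *: v) i ord0 = x i ord0 - s * v i ord0 by rewrite !mxE.
case: sign_s => [[s0 sgn]|[p0 sgn]|[q0 sgn]].
- left; rewrite s0 scale0r subr0 normr0 add0r in xs.
  pose y : 'cV[R]_k.+1 := \col_l if l == i0 then - x i0 ord0 else x l ord0.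
  exists y; last first.
    apply/colP => l; rewrite repl_colE !mxE eqxx.
    by case: eqP => [->|_]/=; rewrite ?mulr1n ?mulr0n eqxx; ring.
  have y0 : y i0 ord0 = - x i0 ord0 by rewrite mxE eqxx.
  have y1 : y i1 ord0 = x i1 ord0 by rewrite mxE eq_sym (negbTE i01).
  apply: wedgesP; first by rewrite y0 y1.
  apply: le_trans xs; rewrite le_eqVlt; apply/orP; left; apply/eqP.
  by apply: eq_bigr => l _; rewrite mxE; case: eqP => // ->; rewrite normrN.
- right; left.
  pose y : 'cV[R]_k.+1 := \col_l if l == i0 then s else (x - s *: v) l ord0.
  have y0 : y i0 ord0 = s by rewrite mxE eqxx.
  have y1 : y i1 ord0 = x i1 ord0 - s * v i1 ord0.
    by rewrite mxE eq_sym (negbTE i01) entry.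
  exists y; last first.
    apply/colP => l; rewrite repl_colE y0.
    case: eqP => [->|/eqP/negbTE li]; first by rewrite add0r mulrC.
    by rewrite mxE li entry; ring.
  apply: wedgesP; first by rewrite y0 y1.
  apply: le_trans xs; rewrite !l1D2 y0 y1 !entry p0 subrr normr0 add0r lerD2l lerD2l.
  rewrite le_eqVlt; apply/orP; left; apply/eqP.
  by apply: eq_bigr => l /andP[/negbTE li _]; rewrite mxE li.
right; right.
pose y : 'cV[R]_k.+1 := \col_l if l == i1 then s else (x - s *: v) l ord0.
have y1 : y i1 ord0 = s by rewrite mxE eqxx.
have y0 : y i0 ord0 = x i0 ord0 - s * v i0 ord0.
  by rewrite mxE (negbTE i01) entry.
exists y; last first.
  apply/colP => l; rewrite repl_colE y1.
  case: eqP => [->|/eqP/negbTE li]; first by rewrite add0r mulrC.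
  by rewrite mxE li entry; ring.
apply: wedgesP.
  by rewrite y0 y1; case: sgn => -[? ?]; [left|right].
apply: le_trans xs; rewrite !l1D2 y0 y1 !entry q0 subrr normr0 add0r.
rewrite addrCA lerD2l lerD2l.
rewrite le_eqVlt; apply/orP; left; apply/eqP.
by apply: eq_bigr => l /andP[_ /negbTE li]; rewrite mxE li.
Qed.

Lemma det_flip : \det flip = -1.
Proof. by rewrite det_repl_col !mxE !eqxx. Qed.

(** The three pieces are images of a wedge and its opposite under maps whose determinants have
    absolute values 1, v_0 and v_1. *)
Lemma vol_hull_with_le (v : 'cV[R]_k.+1) :
  0 < v i0 ord0 -> 0 < v i1 ord0 ->
  off_axes v + 1 <= v i0 ord0 + v i1 ord0 ->
  off_axes v + v i0 ord0 <= 1 + v i1 ord0 ->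
  off_axes v + v i1 ord0 <= 1 + v i0 ord0 ->
  (vol (hull_with v) <= (1 + v i0 ord0 + v i1 ord0)%:E * (vol wedge + vol wedge))%E.
Proof.
move=> v0 v1 e1 e0 e1'.
have flip0 : \det flip != 0 by rewrite det_flip oppr_eq0 oner_neq0.
have r0 : \det (repl_col i0 v) != 0 by rewrite det_repl_col gt_eqF.
have r1 : \det (repl_col i1 v) != 0 by rewrite det_repl_col gt_eqF.
apply: (le_trans (le_vol (hull_with_cover v0 v1 e1 e0 e1'))).
apply: (le_trans (vol_setU _ _)).
apply: (le_trans (leeD (vol_linear_symm_le _ flip0) (vol_setU _ _))).
apply: (le_trans (leeD2l _ (leeD (vol_linear_symm_le _ r0) (vol_linear_symm_le _ r1)))).
rewrite det_flip !det_repl_col normrN1 !gtr0_norm//.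
have v0' : (0 <= (v i0 ord0)%:E)%E by rewrite lee_fin ltW.
have v1' : (0 <= (v i1 ord0)%:E)%E by rewrite lee_fin ltW.
by rewrite -addrA !EFinD !ge0_muleDl ?adde_ge0// lexx.
Qed.

End TwoAxes.
End Pieces.

(** * Lower bounds by cutting into sectors *)

Section LowerBounds.
Context {R : realType}.
Variables (k : nat) (i0 i1 : 'I_k.+1).
Hypothesis i01 : i0 != i1.

Let wedge : set 'cV[R]_k.+1 := wedge i0 i1.

Lemma vol_wedge_gt0 : (0 < vol wedge)%E.
Proof.
(* A cube with this side and a corner at the origin lies in the wedge, since its coordinates sum to
   at most 1. *)
pose c : R := k.+1%:R^-1.
have c0 : 0 < c by rewrite invr_gt0 ltr0n.
have cM : c *+ k.+1 = 1 by rewrite -mulr_natr mulVf// pnatr_eq0.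
have sub : box (0 : 'cV[R]_k.+1) (const_mx c) `<=` wedge.
  move=> x xc; have x_ge0 l : 0 <= x l ord0 by have := xc l; rewrite !mxE => /andP[].
  split=> //; apply: (@le_trans _ _ (\sum_(l < k.+1) c)).
    apply: ler_sum => l _; rewrite ger0_norm//.
    by have := xc l; rewrite !mxE => /andP[].
  by rewrite sumr_const card_ord cM.
apply: lt_le_trans (le_vol sub); apply: lt_le_trans (vol_box_ge _) => [|l].
  by rewrite lte_fin; apply: prodr_gt0 => l _; rewrite !mxE subr0.
by rewrite !mxE ltW.
Qed.

Lemma vol_wedge_fin : vol wedge \is a fin_num.
Proof.
rewrite ge0_fin_numE ?vol_ge0//.
have sub : wedge `<=` box (const_mx (-1) : 'cV[R]_k.+1) (const_mx 1).
  move=> x [_ _ x1] l; rewrite !mxE -ler_norml; apply: le_trans x1.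
  by rewrite /l1 (bigD1 l)//= lerDl; apply: sumr_ge0.
apply: (le_lt_trans (le_vol sub)); apply: le_lt_trans (vol_box _) (ltry _) => l.
by rewrite !mxE; lra.
Qed.

Let flipped : set 'cV[R]_k.+1 := mulmx (flip i0) @` wedge.

Lemma flipE (y : 'cV[R]_k.+1) l :
  (flip i0 *m y) l ord0 = if l == i0 then - y i0 ord0 else y l ord0.
Proof.
by rewrite repl_colE !mxE eqxx andbT; case: eqP => _; rewrite ?mulr1n ?mulr0n; ring.
Qed.

Lemma l1_flip (y : 'cV[R]_k.+1) : l1 (flip i0 *m y) = l1 y.
Proof.
by apply: eq_bigr => l _; rewrite flipE; case: eqP => // ->; rewrite normrN.
Qed.

Lemma vol_flipped : vol flipped = vol wedge.
Proof.
have detf : `|\det (flip i0 : 'M[R]_k.+1)| = 1 by rewrite det_flip normrN1.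
by rewrite vol_linear ?detf ?mul1e// -normr_gt0 detf.
Qed.

Lemma flipped_sign (x : 'cV[R]_k.+1) : flipped x -> x i0 ord0 <= 0 /\ 0 <= x i1 ord0.
Proof.
move=> [y [y0 y1 _] <-]; rewrite !flipE eqxx eq_sym (negbTE i01); split=> //.
by rewrite oppr_le0.
Qed.

(** The hyperplanes x_i0 = 0 and x_i1 = 0 separate [Q], [flipped] and their opposites, all contained
    in [A]: each half is cut along i1, and the halves are cut along i0. [Q] is left general because
    the hexagon fills its quadrant with two wedges and the cross-polytope with one. *)
Lemma vol_four_sectors (Q A : set 'cV[R]_k.+1) :
  (forall x, Q x -> 0 <= x i0 ord0 /\ 0 <= x i1 ord0) ->
  Q `<=` A -> flipped `<=` A -> (forall x, A x -> A (- x)) ->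
  ((vol Q + vol wedge) + (vol Q + vol wedge) <= vol A)%E.
Proof.
move=> Qsign QA fA symA.
have NQA : -%R @` Q `<=` A by move=> _ [x Qx <-]; apply/symA/QA.
have NfA : -%R @` flipped `<=` A by move=> _ [x fx <-]; apply/symA/fA.
have right_half : (vol Q + vol wedge <= vol (Q `|` -%R @` flipped))%E.
  rewrite -[in leLHS]vol_flipped -(vol_opp flipped); apply: (@vol_split _ _ i1).
  - exact: subsetUl.
  - exact: subsetUr.
  - by move=> x /Qsign[].
  by move=> _ [x /flipped_sign[_ x1] <-]; rewrite mxE oppr_le0.
have left_half : (vol Q + vol wedge <= vol (flipped `|` -%R @` Q))%E.
  rewrite -[in leLHS]vol_flipped -(vol_opp Q) addeC; apply: (@vol_split _ _ i1).
  - exact: subsetUl.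
  - exact: subsetUr.
  - by move=> x /flipped_sign[].
  by move=> _ [x /Qsign[_ x1] <-]; rewrite mxE oppr_le0.
apply: (le_trans (leeD right_half left_half)); apply: (@vol_split _ _ i0).
- by move=> x [/QA|/NfA].
- by move=> x [/fA|/NQA].
- by move=> x [/Qsign[]//|[y /flipped_sign[y0 _] <-]]; rewrite mxE oppr_ge0.
by move=> x [/flipped_sign[]//|[y /Qsign[y0 _] <-]]; rewrite mxE oppr_le0.
Qed.

Lemma vol_ball_ge :
  ((vol wedge + vol wedge) + (vol wedge + vol wedge) <=
   vol [set x : 'cV[R]_k.+1 | (l1 x <= 1)%R])%E.
Proof.
apply: vol_four_sectors => [x []//|x []//|_ [x [_ _ x1] <-]|x].
  by rewrite /= l1_flip.
by rewrite /= l1N.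
Qed.

Let e : 'cV[R]_k.+1 := \col_l ((l == i0) || (l == i1))%:R.

Let e0 : e i0 ord0 = 1. Proof. by rewrite mxE eqxx. Qed.
Let e1 : e i1 ord0 = 1. Proof. by rewrite mxE eqxx orbT. Qed.

Lemma repl_col_hull_with (v : 'cV[R]_k.+1) j (y : 'cV[R]_k.+1) :
  l1 y <= 1 -> hull_with v (repl_col j v *m y).
Proof.
move=> y1; exists (y j ord0); apply: le_trans y1; rewrite /l1 [leRHS](bigD1 j)//=.
rewrite lerD2l (bigD1 j)//= mxE repl_colE eqxx !mxE add0r.
rewrite (mulrC (v j ord0)) subrr normr0 add0r le_eqVlt; apply/orP; left; apply/eqP.
apply: eq_bigr => l /negbTE lj; rewrite [in LHS]mxE repl_colE lj !mxE.
by congr `|_|; ring.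
Qed.

(** Two sheared wedges of determinant 1, meeting along x_i0 = x_i1, fill the quadrant of [e]. With
    the flipped wedge and the opposites this makes six sectors of equal volume. *)
Lemma vol_hull_with_ge :
  ((vol wedge + vol wedge + vol wedge) + (vol wedge + vol wedge + vol wedge) <=
   vol (hull_with e))%E.
Proof.
pose T j := mulmx (repl_col j e) @` wedge.
have volT j : e j ord0 = 1 -> vol (T j) = vol wedge.
  by move=> ej; rewrite vol_linear det_repl_col ej ?normr1 ?mul1e// oner_neq0.
have T0E x : T i0 x -> exists2 y, wedge y &
    x i0 ord0 = y i0 ord0 /\ x i1 ord0 = y i0 ord0 + y i1 ord0.
  move=> [y wy <-]; exists y => //; rewrite !repl_colE eqxx (negbTE (_ : i1 != i0)) 1?eq_sym//.
  by rewrite e0 e1; split; ring.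
have T1E x : T i1 x -> exists2 y, wedge y &
    x i1 ord0 = y i1 ord0 /\ x i0 ord0 = y i0 ord0 + y i1 ord0.
  move=> [y wy <-]; exists y => //; rewrite !repl_colE eqxx (negbTE i01).
  by rewrite e0 e1; split; ring.
(* This shear turns the hyperplane x_i0 = x_i1 into a coordinate one, so that [vol_split] can
   separate [T i0] from [T i1]. *)
pose N : 'M[R]_k.+1 := repl_col i1 (delta_mx i1 ord0 - delta_mx i0 ord0).
have NE (x : 'cV[R]_k.+1) : (N *m x) i0 ord0 = x i0 ord0 - x i1 ord0.
  by rewrite /N repl_colE (negbTE i01) !mxE !eqxx (negbTE i01)/= mulr0n mulr1n; ring.
have detN : \det N = 1.
  by rewrite det_repl_col !mxE !eqxx [i1 == i0]eq_sym (negbTE i01)/= subr0.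
have volN A : vol (mulmx N @` A) = vol A.
  by rewrite vol_linear detN ?normr1 ?mul1e// oner_neq0.
have volQ : (vol wedge + vol wedge <= vol (T i0 `|` T i1))%E.
  rewrite -{1}(volT _ e1) -{1}(volT _ e0) -(volN (T i1)) -(volN (T i0)).
  rewrite -(volN (_ `|` _)); apply: (@vol_split _ _ i0).
  - by apply: image_subset; exact: subsetUr.
  - by apply: image_subset; exact: subsetUl.
  - move=> _ [x /T1E[y [y0 y1 _] [x1 x0]] <-]; rewrite NE x0 x1; lra.
  move=> _ [x /T0E[y [y0 y1 _] [x0 x1]] <-]; rewrite NE x0 x1; lra.
apply: (@le_trans _ _ ((vol (T i0 `|` T i1) + vol wedge) +
    (vol (T i0 `|` T i1) + vol wedge))%E).
  by apply: leeD; rewrite leeD2r.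
apply: vol_four_sectors.
- move=> x [/T0E[y [y0 y1 _] [-> ->]]|/T1E[y [y0 y1 _] [-> ->]]]; split=> //; lra.
- by move=> _ [|] [y [_ _ y1] <-]; exact: repl_col_hull_with.
- by move=> _ [y [_ _ y1] <-]; exists 0; rewrite scale0r subr0 normr0 add0r l1_flip.
by move=> x [r xr]; exists (- r); rewrite normrN scaleNr -opprD l1N.
Qed.

End LowerBounds.

(** * The hexagonal frame *)

Section Continuity.
Context {R : realType} {T : topologicalType}.

Lemma continuous_det n (f : T -> 'M[R]_n) :
  (forall i j, continuous (fun x => f x i j)) -> continuous (fun x => \det (f x)).
Proof.
move=> fc; rewrite /determinant.
apply: (@continuous_big R _ +%R 0 predT) => [|s _]; first exact: add_continuous.
move=> x; apply: cvgM; first exact: cvg_cst.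
move: x; apply: (@continuous_big R _ *%R 1 predT) => [|i _]; last exact: fc.
exact: mul_continuous.
Qed.

Lemma continuous_adj n (f : T -> 'M[R]_n) :
  (forall i j, continuous (fun x => f x i j)) ->
  forall i j, continuous (fun x => (\adj (f x)) i j).
Proof.
move=> fc i j; under eq_fun do rewrite mxE /cofactor.
move=> x; apply: cvgM; first exact: cvg_cst.
move: x; apply: continuous_det => a b; under eq_fun do rewrite !mxE.
exact: fc.
Qed.

Lemma continuous_mulmx m n p (f : T -> 'M[R]_(m, n)) (g : T -> 'M[R]_(n, p)) :
  (forall i j, continuous (fun x => f x i j)) ->
  (forall i j, continuous (fun x => g x i j)) ->
  forall i j, continuous (fun x => (f x *m g x) i j).
Proof.
move=> fc gc i j; under eq_fun do rewrite mxE.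
apply: (@continuous_big R _ +%R 0 predT) => [|l _]; first exact: add_continuous.
by move=> x; apply: cvgM; [exact: fc|exact: gc].
Qed.

End Continuity.

(** * Upper bound for frames near the hexagonal one *)

Section UpperBound.
Context {R : realType}.
Variables (m l : nat).
Notation k := m.+2.
Notation i0 := (ord0 : 'I_k).
Notation i1 := (ord_max : 'I_k).
Notation q := (vol (@wedge R m.+1 i0 i1)).

Definition pair_vec : 'cV[R]_k := \col_i ((i == i0) || (i == i1))%:R.
Notation e := pair_vec.

Lemma pair_vecTmul (v : 'cV[R]_k) : (e^T *m v) 0 0 = v i0 ord0 + v i1 ord0.
Proof.
rewrite mxE (bigD1 i0)//= (bigD1 i1)//= big1 ?addr0 => [|i /andP[i0' i1']].
  by rewrite !mxE !eqxx orbT !mul1r.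
by rewrite !mxE (negbTE i0') (negbTE i1') mul0r.
Qed.

(** Subtracting from the first column the combination of the others with coefficients [v] clears M v
    and leaves a block upper triangular matrix. *)
Lemma det_bordered (M : 'M[R]_k) (v : 'cV[R]_k) :
  \det (block_mx (-1)%:M e^T (M *m v) M : 'M[R]_(1 + k)) =
  - (1 + v i0 ord0 + v i1 ord0) * \det M.
Proof.
have XE : (block_mx (-1)%:M e^T (M *m v) M : 'M[R]_(1 + k)) *m
    block_mx 1%:M 0 (- v) 1%:M =
    block_mx (- (1 + v i0 ord0 + v i1 ord0))%:M e^T 0 M.
  rewrite mulmx_block !mulmx1 !mulmx0 !add0r !mulmxN subrr; congr block_mx.
  by rewrite [e^T *m v]mx11_scalar pair_vecTmul -raddfB/=; congr _%:M; ring.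
have := congr1 determinant XE.
by rewrite det_mulmx det_lblock !det1 !mulr1 det_ublock det_scalar1.
Qed.

(** Below its first row the bordered matrix is the frame with the columns [U] deleted, so those rows
    have norm at most 1. *)
Lemma bordered_bound (M : 'M[R]_k) (v : 'cV[R]_k) (U : 'M[R]_(k, l)) :
  row_mx (M *m v) (row_mx M U) *m (row_mx (M *m v) (row_mx M U))^T = 1%:M ->
  `|\det M| * `|1 + v i0 ord0 + v i1 ord0| <= Num.sqrt 3.
Proof.
move=> SS1; pose X : 'M[R]_(1 + k) := block_mx (-1)%:M e^T (M *m v) M.
have diag i : (M *m v *m (M *m v)^T) i i + (M *m M^T) i i <= 1.
  have := congr1 (fun A : 'M[R]_k => A i i) SS1.
  rewrite !tr_row_mx !mul_row_col [RHS]mxE eqxx mulr1n => <-.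
  by rewrite [leRHS]mxE lerD2l [leRHS]mxE lerDl gram_ge0.
have had := hadamard X.
have entry0 : (X *m X^T) (lshift k 0) (lshift k 0) = 3.
  rewrite tr_block_mx mulmx_block block_mxEul [LHS]mxE trmxK pair_vecTmul.
  rewrite !mxE big_ord1 !mxE !eqxx orbT !mulr1n; ring.
have entry i : (X *m X^T) (rshift 1 i) (rshift 1 i) =
    (M *m v *m (M *m v)^T) i i + (M *m M^T) i i.
  by rewrite tr_block_mx mulmx_block block_mxEdr mxE.
have prod3 : \prod_i (X *m X^T) i i <= 3.
  rewrite (@big_split_ord _ _ _ 1 k)/= big_ord1.
  have -> : (X *m X^T) (lshift k ord0) (lshift k ord0) = 3 by exact: entry0.
  rewrite -[leRHS]mulr1 ler_pM2l ?ltr0n//.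
  apply: (@le_trans _ _ (\prod_(i < k) 1)); last by rewrite big1.
  apply: ler_prod => i _; rewrite gram_ge0/=; apply: le_trans (diag i).
  by rewrite -entry.
rewrite -normrM -sqrtr_sqr ler_wsqrtr//; apply: le_trans prod3.
apply: le_trans had; rewrite det_bordered le_eqVlt; apply/orP; left; apply/eqP; ring.
Qed.

(** A column of [U] has l1 norm at most 1, hence already lies in the cross-polytope of the basis:
    its coefficient can be redistributed over the basis vectors at no extra cost. *)
Lemma hull_sub (M : 'M[R]_k) (v : 'cV[R]_k) (U : 'M[R]_(k, l)) :
  (forall j, \sum_i `|U i j| <= 1) ->
  sym_hull (M *m row_mx v (row_mx 1%:M U)) `<=` mulmx M @` hull_with v.
Proof.
move=> U1 x /sym_hull_image[z /= z1 <-]; rewrite -mulmxA.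
exists (row_mx v (row_mx 1%:M U) *m z) => //.
pose r := z (lshift _ ord0) ord0.
pose y := usubmx (dsubmx z); pose u := dsubmx (dsubmx z).
have zE : z = col_mx r%:M (col_mx y u).
  rewrite -[LHS]vsubmxK -[dsubmx z in LHS]vsubmxK; congr col_mx.
  by apply/matrixP => i j; rewrite !ord1 !mxE mulr1n.
have l1z : l1 z = `|r| + (l1 y + l1 u).
  rewrite /l1 (@big_split_ord _ _ _ 1 (k + l))/= big_ord1 big_split_ord/=.
  congr (_ + (_ + _)); apply: eq_bigr => i _; by rewrite !mxE.
exists r; apply: le_trans z1; rewrite l1z lerD2l zE !mul_row_col mul1mx mul_mx_scalar.
rewrite addrAC subrr add0r.
have Uu : l1 (U *m u) <= l1 u.
  rewrite /l1; apply: (@le_trans _ _ (\sum_i \sum_j `|U i j| * `|u j ord0|)).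
    apply: ler_sum => i _; rewrite mxE; apply: (le_trans (ler_norm_sum _ _ _)).
    by apply: ler_sum => j _; rewrite normrM.
  rewrite exchange_big/=; apply: ler_sum => j _.
  by rewrite -mulr_suml -[leRHS]mul1r ler_wpM2r.
apply: (@le_trans _ _ (l1 y + l1 (U *m u))); last by rewrite lerD2l.
by rewrite /l1 -big_split/=; apply: ler_sum => i _; rewrite mxE ler_normD.
Qed.

Lemma vol_hull_le (M : 'M[R]_k) (v : 'cV[R]_k) (U : 'M[R]_(k, l)) S :
  \det M != 0 -> S = M *m row_mx v (row_mx 1%:M U) -> S *m S^T = 1%:M ->
  (forall i, `|v i ord0 - e i ord0| <= (4 * k%:R)^-1) ->
  (forall i j, `|U i j| <= (4 * k%:R)^-1) ->
  (F S <= (Num.sqrt 3)%:E * (q + q))%E.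
Proof.
move=> M0 SE SS1 ve Ue; set d : R := (4 * k%:R)^-1 in ve Ue.
have k2 : 2 <= k%:R :> R by rewrite ler_nat.
(* The tolerance makes any k errors sum to at most 1/4, while k >= 2 keeps each one below 1/8. So
   v_0 and v_1 lie between 7/8 and 9/8, [off_axes] is at most 1/4, and the three slack inequalities
   follow. *)
have kd : d *+ k = 4^-1.
  by rewrite -(mulr_natr d) /d invfM -mulrA mulVf ?mulr1// pnatr_eq0.
have d8 : d <= 8^-1.
  have d0 : 0 <= d by rewrite invr_ge0 mulr_ge0.
  have := ler_wpM2l d0 k2; rewrite (mulr_natr d k) kd; clear; move: d => z; lra.
have U1 j : \sum_i `|U i j| <= 1.
  apply: (@le_trans _ _ (\sum_(i < k) d)); first exact: ler_sum.
  by rewrite sumr_const card_ord kd invf_le1// ler1n.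
have off : off_axes i0 i1 v <= 4^-1.
  apply: (@le_trans _ _ (\sum_(i < k) d)); last by rewrite sumr_const card_ord kd.
  rewrite /off_axes big_mkcond/=; apply: ler_sum => i _; case: ifP => [/andP[n0 n1]|_].
    by have := ve i; rewrite [e _ _]mxE (negbTE n0) (negbTE n1) subr0.
  by apply: le_trans (ve i).
have := ve i0; have := ve i1; rewrite [e i0 _]mxE [e i1 _]mxE !eqxx orbT/= !ler_norml.
move=> /andP[v1l v1u] /andP[v0l v0u].
have v0 : 0 < v i0 ord0 by move: v0l; clear -d8; move: (v _ _) => z; lra.
have v1 : 0 < v i1 ord0 by move: v1l; clear -d8; move: (v _ _) => z; lra.
have bnd : `|\det M| * (1 + v i0 ord0 + v i1 ord0) <= Num.sqrt 3.
  have s0 : 0 <= 1 + v i0 ord0 + v i1 ord0.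
    by apply: addr_ge0; [apply: addr_ge0 => //|]; exact: ltW.
  rewrite -(ger0_norm s0).
  by apply: (@bordered_bound M v (M *m U)); rewrite SE !mul_mx_row mulmx1 in SS1.
have vol_le : (vol (hull_with v) <= (1 + v i0 ord0 + v i1 ord0)%:E * (q + q))%E.
  apply: vol_hull_with_le => //; move: v0l v0u v1l v1u off; clear -d8;
    by move: (off_axes _ _ _) (v _ _) (v _ _) => o a b; lra.
rewrite /F SE; apply: (le_trans (le_vol (hull_sub (M := M) (v := v) U1))).
rewrite vol_linear//.
apply: (@le_trans _ _ (`|\det M|%:E * ((1 + v i0 ord0 + v i1 ord0)%:E * (q + q)))%E).
  by rewrite lee_wpmul2l.
by rewrite muleA -EFinM lee_wpmul2r ?adde_ge0 ?vol_ge0// lee_fin.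
Qed.

End UpperBound.

(** * The local maximum and its comparison with the cross-polytope *)

Section Main.
Context {R : realType}.
Variables (m l : nat).
Notation k := m.+2.
Notation e := (@pair_vec R m).
Notation q := (vol (@wedge R m.+1 ord0 ord_max)).

Lemma ord0_neq_max : (ord0 : 'I_k) != ord_max.
Proof. by []. Qed.

(** The first column is the one near b, the next k columns are those near a, the orthonormal basis
    and c, and the last l columns are near 0; this is the middle block. *)
Definition core (S : 'M[R]_(k, 1 + (k + l))) : 'M[R]_k := lsubmx (rsubmx S).

(* [(core S)^-1 *m S], written with the adjugate to make its continuity plain. *)
Definition coords (S : 'M[R]_(k, 1 + (k + l))) : 'M[R]_(k, 1 + (k + l)) :=
  (\det (core S))^-1 *: (\adj (core S) *m S).

Lemma coordsE S : \det (core S) != 0 ->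
  S = core S *m row_mx (lsubmx (coords S)) (row_mx 1%:M (rsubmx (rsubmx (coords S)))).
Proof.
move=> S0.
have -> : 1%:M = lsubmx (rsubmx (coords S)).
  rewrite /coords !linearZ/= -!mulmx_rsub -mulmx_lsub mul_adj_mx.
  by rewrite scale_scalar_mx mulVf.
rewrite !hsubmxK /coords -scalemxAr mulmxA mul_mx_adj mul_scalar_mx scalerA.
by rewrite mulVf// scale1r.
Qed.

Lemma coords_mul (M : 'M[R]_k) v U : \det M != 0 ->
  coords (M *m row_mx v (row_mx 1%:M U)) = row_mx v (row_mx 1%:M U).
Proof.
move=> M0; have coreM : core (M *m row_mx v (row_mx 1%:M U)) = M.
  by rewrite /core !mul_mx_row row_mxKr row_mxKl mulmx1.
rewrite /coords coreM mulmxA mul_adj_mx mul_scalar_mx scalerA mulVf//.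
by rewrite scale1r.
Qed.

Lemma continuous_core i j : continuous (fun S => core S i j).
Proof. by under eq_fun do rewrite !mxE; exact: coord_continuous. Qed.

Lemma coords_near S0 (d : R) : \det (core S0) != 0 -> 0 < d ->
  \forall S \near S0, \det (core S) != 0 /\
    forall i j, `|coords S i j - coords S0 i j| <= d.
Proof.
move=> S00 d0.
have det_cvg : \det (core S) @[S --> S0] --> \det (core S0).
  exact: (continuous_det continuous_core).
suff near_ij : \forall S \near S0, forall i j, `|coords S i j - coords S0 i j| <= d.
  exact: filterI (cvgr_neq0 _ det_cvg S00) near_ij.
apply: (@filter_forall _ _ _ (nbhs S0)) => i; apply: (@filter_forall _ _ _ (nbhs S0)) => j.
have cvg_ij : coords S i j @[S --> S0] --> coords S0 i j.
  have inv_cvg : (\det (core S))^-1 @[S --> S0] --> (\det (core S0))^-1.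
    exact: (cvgV S00 det_cvg).
  have E S : coords S i j = (\det (core S))^-1 * (\adj (core S) *m S) i j.
    by rewrite mxE.
  have -> : (fun S => coords S i j) =
      (fun S => (\det (core S))^-1 * (\adj (core S) *m S) i j) by apply/funext.
  rewrite E; apply: (cvgM inv_cvg).
  apply: (continuous_mulmx (f := fun S => \adj (core S)) (g := id)) => a b.
    by apply: continuous_adj => c c'; exact: continuous_core.
  exact: coord_continuous.
by have /cvgr_distC_le := cvg_ij; apply.
Qed.

(* [M = 1 - shrink e e^T] is the positive square root of [(1 + e e^T)^-1]. *)
Definition shrink : R := (1 - (Num.sqrt 3)^-1) / 2.

Definition hexagon_core : 'M[R]_k := 1%:M - shrink *: (e *m e^T).

(* Its columns are [b = a + c], the columns of [hexagon_core] (where [a] and [c] are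
   the first and the last one), and zeros. *)
Definition hexagon_frame : 'M[R]_(k, 1 + (k + l)) :=
  hexagon_core *m row_mx e (row_mx 1%:M 0).

Lemma eTe : e^T *m e = 2%:M.
Proof.
rewrite [LHS]mx11_scalar pair_vecTmul !mxE !eqxx orbT.
by congr _%:M; ring.
Qed.

Lemma hexagon_coreT : hexagon_core^T = hexagon_core.
Proof. by rewrite /hexagon_core linearB/= linearZ/= trmx1 trmx_mul trmxK. Qed.

(** On the line of [e], where e e^T acts as 2, [hexagon_core] acts as 1 - 2 g with g = [shrink]. The
    uframe condition there is 3 (1 - 2 g)^2 = 1, which is twice this equation. *)
Lemma shrinkE : 1 - 6 * shrink + 6 * shrink ^+ 2 = 0.
Proof.
have s3 : (Num.sqrt 3 : R) != 0 by rewrite sqrtr_eq0 -ltNge.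
have s3' : (Num.sqrt 3)^-1 ^+ 2 = 3^-1 :> R by rewrite exprVn sqr_sqrtr.
rewrite /shrink; move: s3'; move: (_^-1) => t tE.
have -> : 1 - 6 * ((1 - t) / 2) + 6 * ((1 - t) / 2) ^+ 2 = (3 * t ^+ 2 - 1) / 2 by field.
by rewrite tE; field.
Qed.

Lemma hexagon_core_gram :
  hexagon_core *m (e *m e^T) *m hexagon_core + hexagon_core *m hexagon_core = 1%:M.
Proof.
pose E := e *m e^T; have EE : E *m E = 2 *: E.
  by rewrite /E mulmxA -(mulmxA e) eTe mul_mx_scalar -scalemxAl.
rewrite -/E /hexagon_core -/E; move: EE shrinkE; move: E shrink => E g EE gE.
have cE : (1%:M - g *: E) *m E = (1 - 2 * g) *: E.
  by rewrite mulmxBl mul1mx -scalemxAl EE scalerA scalerBl scale1r mulrC.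
have Ec : E *m (1%:M - g *: E) = (1 - 2 * g) *: E.
  by rewrite mulmxBr mulmx1 -scalemxAr EE scalerA scalerBl scale1r mulrC.
have cc : (1%:M - g *: E) *m (1%:M - g *: E) = 1%:M - g *: E - (g * (1 - 2 * g)) *: E.
  by rewrite {1}mulmxBl mul1mx -scalemxAl Ec scalerA.
rewrite cc cE -scalemxAl Ec scalerA; apply/matrixP => i j; rewrite !mxE.
move: (E i j) (_ == _) => x b.
have -> : (1 - 2 * g) * (1 - 2 * g) * x + (b%:R - g * x - g * (1 - 2 * g) * x) =
  b%:R + (1 - 6 * g + 6 * g ^+ 2) * x by ring.
by rewrite gE mul0r addr0.
Qed.

Lemma hexagon_frame_gram : hexagon_frame *m hexagon_frame^T = 1%:M.
Proof.
rewrite /hexagon_frame trmx_mul hexagon_coreT !tr_row_mx trmx0 trmx1 mulmxA.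
rewrite -(mulmxA hexagon_core).
rewrite !mul_row_col !mulmx1 mul0mx addr0.
by rewrite mulmxDr mulmx1 mulmxDl hexagon_core_gram.
Qed.

(** This is the equality case of Hadamard: the rows of the bordered matrix are orthogonal, its
    squared determinant is 3, and by [det_bordered] it is also 9 times that of the core. *)
Lemma det_hexagon_core : `|\det hexagon_core| = (Num.sqrt 3)^-1.
Proof.
pose X : 'M[R]_(1 + k) := block_mx (-1)%:M e^T (hexagon_core *m e) hexagon_core.
have XX : X *m X^T = block_mx 3%:M 0 0 1%:M.
  rewrite /X tr_block_mx mulmx_block trmx_mul hexagon_coreT trmxK tr_scalar_mx.
  rewrite !mul_scalar_mx !mul_mx_scalar eTe mulmxA -(mulmxA hexagon_core e) hexagon_core_gram.
  congr block_mx.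
  - by rewrite scale_scalar_mx -raddfD/=; congr _%:M; ring.
  - by rewrite scaleN1r addNr.
  - by rewrite scaleN1r addNr.
have := congr1 determinant XX.
rewrite det_mulmx det_tr det_ublock det1 mulr1 det_scalar1 det_bordered.
rewrite !mxE !eqxx orbT/= => dd.
have d2 : (\det hexagon_core) ^+ 2 = 3^-1.
  have -> : (\det hexagon_core) ^+ 2 = 3 / 9 by rewrite -dd; field.
  by field.
by rewrite -sqrtr_sqr d2 sqrtrV.
Qed.

Lemma uframe_gram n (S : 'M[R]_(k, n)) : S *m S^T = 1%:M -> uframe S.
Proof.
move=> SS; split=> //; apply/eqP; rewrite eqn_leq rank_leq_row/=.
by rewrite -{1}(mxrank1 R k) -SS mxrankM_maxl.
Qed.

Definition standard_frame : 'M[R]_(k, 1 + (k + l)) := row_mx 0 (row_mx 1%:M 0).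

Lemma F_standard_ge : ((q + q) + (q + q) <= F standard_frame)%E.
Proof.
apply: (le_trans (vol_ball_ge ord0_neq_max)); apply: le_vol.
apply: (subset_trans _ (image_sym_hull (S := standard_frame) isT)) => x x1.
exists (col_mx 0 (col_mx x 0)).
  apply: le_trans x1; rewrite /l1 (@big_split_ord _ _ _ 1 (k + l))/= big_ord1.
  rewrite big_split_ord/= !col_mxEu mxE normr0 add0r [X in _ + X]big1 => [|i _].
    rewrite addr0 le_eqVlt; apply/orP; left; apply/eqP; apply: eq_bigr => i _.
    by rewrite col_mxEd col_mxEu.
  by rewrite !col_mxEd mxE normr0.
by rewrite /standard_frame !mul_row_col !mul0mx mul1mx add0r addr0.
Qed.

(** The six wedges are scaled by the determinant of the core, and 6 q / sqrt 3 = 2 sqrt 3 q. *)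
Lemma F_hexagon_frame_ge : ((Num.sqrt 3)%:E * (q + q) <= F hexagon_frame)%E.
Proof.
have det0 : \det hexagon_core != 0.
  by rewrite -normr_gt0 det_hexagon_core invr_gt0 sqrtr_gt0.
apply: (@le_trans _ _ (vol (mulmx hexagon_core @` hull_with e))).
  rewrite vol_linear// det_hexagon_core.
  apply: le_trans (lee_wpmul2l _ (vol_hull_with_ge ord0_neq_max)); last first.
    by rewrite lee_fin invr_ge0 sqrtr_ge0.
  rewrite -(fineK (vol_wedge_fin ord0 ord_max)) -!EFinD -!EFinM lee_fin.
  have s3 : (Num.sqrt 3 : R) != 0 by rewrite sqrtr_eq0 -ltNge.
  have s3' : Num.sqrt 3 * Num.sqrt 3 = 3 :> R by rewrite -expr2 sqr_sqrtr.
  move: (fine _) => w; rewrite le_eqVlt; apply/orP; left; apply/eqP.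
  apply: (mulfI s3); rewrite !mulrA s3' divff//; ring.
apply: le_vol; apply: (subset_trans _ (image_sym_hull (S := hexagon_frame) isT)).
move=> _ [x [r xr] <-].
exists (col_mx r%:M (col_mx (x - r *: e) 0)).
  apply: le_trans xr; rewrite /l1 (@big_split_ord _ _ _ 1 (k + l))/= big_ord1.
  rewrite big_split_ord/= !col_mxEu mxE mulr1n [X in _ + (_ + X)]big1 => [|i _].
    rewrite addr0 lerD2l le_eqVlt; apply/orP; left; apply/eqP; apply: eq_bigr => i _.
    by rewrite col_mxEd col_mxEu.
  by rewrite !col_mxEd mxE normr0.
rewrite /hexagon_frame -mulmxA !mul_row_col mul_mx_scalar mul1mx mul0mx addr0.
by rewrite addrC subrK.
Qed.

Lemma F_near_hexagon_frame : \forall S \near hexagon_frame, Omega S ->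
  (F S <= (Num.sqrt 3)%:E * (q + q))%E.
Proof.
have det0 : \det hexagon_core != 0.
  by rewrite -normr_gt0 det_hexagon_core invr_gt0 sqrtr_gt0.
have core_hexagon_frame : core hexagon_frame = hexagon_core.
  by rewrite /core /hexagon_frame !mul_mx_row row_mxKr row_mxKl mulmx1.
have d0 : 0 < (4 * k%:R)^-1 :> R by rewrite invr_gt0 mulr_gt0 ?ltr0n.
have := @coords_near hexagon_frame _ _ d0; rewrite core_hexagon_frame => /(_ det0).
apply: filterS => S [S0 near0] [_ SS].
rewrite /hexagon_frame coords_mul// in near0.
apply: (vol_hull_le S0 (coordsE S0) SS) => [i|i j].
  by have := near0 i (lshift _ ord0); rewrite row_mxEl [lsubmx _ _ _]mxE.
have := near0 i (rshift _ (rshift _ j)); rewrite !row_mxEr [(0 : 'M[R]_(k, l)) _ _]mxE subr0.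
by rewrite [rsubmx _ _ _]mxE [rsubmx _ _ _]mxE.
Qed.

End Main.

Theorem theorem4 (R : realType) (n k : nat) :
  (2 <= k)%N -> (k < n)%N ->
  exists S : 'M[R]_(k, n),
    [/\ @Omega R n k S,
        (* local maximum of F on Omega(n,k) (Euclidean topology on R^{k x n}) *)
        (\forall S' \near S, @Omega R n k S' -> (F S' <= F S)%E) &
        (* ... which is not the global maximum on Omega(n,k) *)
        exists S'' : 'M[R]_(k, n), @Omega R n k S'' /\ (F S < F S'')%E].
Proof.
case: k => [|[|m]]// _ kn.
have [l ->] : exists l, n = (1 + (m.+2 + l))%N.
  by exists (n - m.+3)%N; rewrite addnA add1n subnKC.
have om0 : Omega (hexagon_frame m l : 'M[R]_(m.+2, _)).
  exact/uframe_gram/hexagon_frame_gram.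
have om1 : Omega (standard_frame m l : 'M[R]_(m.+2, _)).
  apply: uframe_gram; rewrite /standard_frame !tr_row_mx !mul_row_col.
  by rewrite !trmx0 !mulmx0 trmx1 mulmx1 add0r addr0.
exists (hexagon_frame m l); split=> //.
  apply: filterS (F_near_hexagon_frame m l) => S + omS => /(_ omS) /le_trans; apply.
  exact: F_hexagon_frame_ge.
exists (standard_frame m l); split=> //.
(* The upper bound valid near the hexagonal frame holds in particular at the frame itself; it
   remains to see that 2 sqrt 3 q < 4 q, where 0 < q < oo makes the inequality strict. *)
apply: le_lt_trans (nbhs_singleton (F_near_hexagon_frame m l) om0) _.
apply: lt_le_trans (F_standard_ge m l).
have q0 := @vol_wedge_gt0 R m.+1 ord0 ord_max.
have := vol_wedge_fin (R := R) (k := m.+1) ord0 ord_max.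
move: q0; case: (vol _) => [w| |]//; rewrite lte_fin => w0 _.
rewrite -!EFinD -EFinM lte_fin -(mul1r (w + w)) -mulrDl mul1r.
rewrite ltr_pM2r ?addr_gt0//.
rewrite -(ltr_pXn2r (n := 2))// ?nnegrE ?sqrtr_ge0//.
rewrite sqr_sqrtr//; lra.
Qed.
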